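(* Let $p\ge7$ be a prime, $d=p-1=hk$ with positive integers $h,k$, $c=2p-8$, $n\ge\max\{c,8\}$ and $0\le e\le n-c$. Let $i,j\in\{0,\dots,d-1\}$, $x\in\Omega_{n,i}$ and $y\in\Omega_{n,j}$. Then $C_{n,e}(x)\cong C_{n,e}(y)$ if and only if $i=j$ and $(v,\sigma^m)(x)\equiv y\bmod\Gamma_{n+e}$ for some $v\in\ker(\chi)$ and $m\in\{0,\dots,k-1\}$.
   Context: NUMBER THEORY. Put $\ell=(p-3)/2$. Let $\theta$ be a primitive $p$-th root of unity over $\mathbb Q_p$, $\mathbb K=\mathbb Q_p(\theta)$, $\mathcal O=\mathbb Z_p[\theta]$, $\mathfrak p=(\theta-1)$ its maximal ideal, $\mathfrak p^m$ ($m\in\mathbb Z$) the fractional ideals, $\mathcal U=\mathcal O^\times$, $\omega\in\mathbb Z_p$ a primitive $d$-th root of unity. For $i$ coprime to $p$ let $\sigma_i$ be the automorphism of $\mathbb K$ with $\theta\mapsto\theta^i$; $\mathcal G=\{\sigma_1,\dots,\sigma_d\}$ is the (cyclic) Galois group of $\mathbb K/\mathbb Q_p$; $\sigma$ is a fixed generator of $\mathcal G$, and $\tau=\sigma^k$, of order $h$. Let $\chi:\mathcal U\to\mathcal U$, $u\mapsto u\tau(u)^{-1}$. SKELETON GROUPS. For $2\le i\le\ell+1$ let $\mathbb S_i(a\wedge b)=\sigma_i(a)\sigma_{1-i}(b)-\sigma_{1-i}(a)\sigma_i(b)$. Let $\operatorname{Hom}$ be the group of $\mathbb Z_p$-homomorphisms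 $f:\mathcal O\wedge\mathcal O\to\mathcal O$ with $f(\theta a\wedge\theta b)=\theta f(a\wedge b)$. Every $f\in\operatorname{Hom}$ is uniquely $f=\mathbb S(x)=x_1\mathbb S_2+\dots+x_\ell\mathbb S_{\ell+1}$ with $x\in\mathbb K^\ell$. Let $\Gamma_m$ be the set of all $x\in\mathbb K^\ell$ with $\mathbb S(x)(\mathcal O\wedge\mathcal O)\subseteq\mathfrak p^{m-1}$ and $\Delta_m=\Gamma_m\setminus\Gamma_{m+1}$ (image equal to $\mathfrak p^{m-1}$). For $x\in\Delta_n$ and $0\le e\le n-c$, $M_{n,e}(\mathbb S(x))$ is the group on $\mathcal O/\mathfrak p^{n+e-1}$ with multiplication $(a+\mathfrak p^{n+e-1})\circ(b+\mathfrak p^{n+e-1})=a+b+\tfrac12\mathbb S(x)(a\wedge b)+\mathfrak p^{n+e-1}$, and $C_{n,e}(x)=M_{n,e}(\mathbb S(x))\rtimes\langle\theta\rangle$ with $\theta$ acting by multiplication. The group $\mathcal U\rtimes\mathcal G$ acts on $\mathbb K^\ell$ by $(u,\varphi)(x)=(\rho_2(u)^{-1}\varphi(x_1),\dots,\rho_{\ell+1}(u)^{-1}\varphi(x_\ell))$, where $\rho_i(u)=u^{-1}\sigma_i(u)\sigma_{1-i}(u)$. For $i\in\{0,\dots,d-1\}$ let $\Omega_{n,i}=\{x\in\Delta_n:(1,\tau)(x)=\omega^ix\}$.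
   Formalization: The case e=0 with i≠j is excluded: for e=0 the group C_{n,0}(x) does not depend on x∈Δ_n, so all these groups are isomorphic and the stated equivalence fails there (e.g. p=7, k=1); the formal theorem assumes that e=0 implies i=j. *)

(* Defs.v *)
From HB Require Import structures.
From mathcomp Require Import all_boot all_order all_fingroup all_algebra all_solvable all_field.
From mathcomp Require Import generic_quotient ring_quotient boolp classical_sets.

Set Implicit Arguments.
Unset Strict Implicit.
Unset Printing Implicit Defensive.

Import GRing.Theory.

Local Open Scope ring_scope.

(* The ring of p-adic integers as the inverse limit of the rings Z / p^n: an
   element is the sequence of its residues, the n-th one in [0, p^n). The
   compatibility condition also forces the n-th residue into that range. *)
Definition padic_compat (p : nat) (a : nat -> int) : Prop :=
  forall n, a n = (a n.+1 %% p%:Z ^+ n)%Z.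

(* The primality proof is a parameter so that the ring is a domain. *)
Record padic_int (p : nat) (p_pr : prime p) := PadicInt {
  residue : nat -> int;
  residueP : padic_compat p residue }.

Section PadicInt.

Variables (p : nat) (p_pr : prime p).
Local Notation Zp := (padic_int p_pr).
Local Notation P n := (p%:Z ^+ n).

HB.instance Definition _ := gen_eqMixin Zp.
HB.instance Definition _ := gen_choiceMixin Zp.

Lemma padic_eqP (a b : Zp) : (forall n, residue a n = residue b n) -> a = b.
Proof.
case: a b => [a aP] [b bP] /= /funext ab; case: _ / ab in bP *.
by rewrite (Prop_irrelevance aP bP).
Qed.

Lemma residue_mod (a : Zp) n : (residue a n %% P n)%Z = residue a n.
Proof. by rewrite (residueP a n) modz_mod. Qed.

Lemma modz_modX m n x : (m <= n)%N -> ((x %% P n)%Z %% P m)%Z = (x %% P m)%Z.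
Proof.
move=> /subnK <-; rewrite exprD [in RHS](divz_eq x (P (n - m) * P m)).
by rewrite mulrA modzMDl.
Qed.

Lemma padic_reduce_subproof (f : nat -> int) :
  (forall n, (f n.+1 %% P n = f n %% P n)%Z) ->
  padic_compat p (fun n => f n %% P n)%Z.
Proof. by move=> fP n; rewrite modz_modX ?fP. Qed.

Definition padic_reduce f fP : Zp := PadicInt p_pr (@padic_reduce_subproof f fP).

Lemma const_compat (x : int) n : (x %% P n = x %% P n)%Z. Proof. by []. Qed.
Lemma add_compat (a b : Zp) n :
  ((residue a n.+1 + residue b n.+1) %% P n
   = (residue a n + residue b n) %% P n)%Z.
Proof. by rewrite (residueP a n) (residueP b n) modzDm. Qed.
Lemma opp_compat (a : Zp) n :
  ((- residue a n.+1) %% P n = (- residue a n) %% P n)%Z.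
Proof. by rewrite (residueP a n) modzNm. Qed.
Lemma mul_compat (a b : Zp) n :
  ((residue a n.+1 * residue b n.+1) %% P n
   = (residue a n * residue b n) %% P n)%Z.
Proof. by rewrite (residueP a n) (residueP b n) modzMm. Qed.

Definition padic_const x := padic_reduce (const_compat x).
Definition padic_add a b := padic_reduce (add_compat a b).
Definition padic_opp a := padic_reduce (opp_compat a).
Definition padic_mul a b := padic_reduce (mul_compat a b).

Lemma padic_addA : associative padic_add.
Proof. by move=> a b c; apply: padic_eqP => n /=; rewrite modzDmr modzDml addrA. Qed.
Lemma padic_addC : commutative padic_add.
Proof. by move=> a b; apply: padic_eqP => n /=; rewrite addrC. Qed.
Lemma padic_add0 : left_id (padic_const 0) padic_add.
Proof. by move=> a; apply: padic_eqP => n /=; rewrite modzDml add0r residue_mod. Qed.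
Lemma padic_addN : left_inverse (padic_const 0) padic_opp padic_add.
Proof. by move=> a; apply: padic_eqP => n /=; rewrite modzDml addNr. Qed.

HB.instance Definition _ :=
  GRing.isZmodule.Build Zp padic_addA padic_addC padic_add0 padic_addN.

Lemma padic_mulA : associative padic_mul.
Proof. by move=> a b c; apply: padic_eqP => n /=; rewrite modzMmr modzMml mulrA. Qed.
Lemma padic_mulC : commutative padic_mul.
Proof. by move=> a b; apply: padic_eqP => n /=; rewrite mulrC. Qed.
Lemma padic_mul1 : left_id (padic_const 1) padic_mul.
Proof. by move=> a; apply: padic_eqP => n /=; rewrite modzMml mul1r residue_mod. Qed.
Lemma padic_mulD : left_distributive padic_mul +%R.
Proof.
by move=> a b c; apply: padic_eqP => n /=; rewrite modzMml modzDm mulrDl.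
Qed.
Lemma padic_1neq0 : padic_const 1 != 0.
Proof.
apply/eqP => /(congr1 (fun a : Zp => residue a 1)) /=.
by rewrite expr1 mod0z modz_small //= ltz_nat prime_gt1.
Qed.

HB.instance Definition _ := GRing.Zmodule_isComNzRing.Build Zp
  padic_mulA padic_mulC padic_mul1 padic_mulD padic_1neq0.

Definition padic_unit : {pred Zp} := fun a => `[< exists b : Zp, b * a = 1 >].
Definition padic_inv (a : Zp) : Zp :=
  if pselect (exists b : Zp, b * a = 1) is left ex then sval (cid ex) else a.

Lemma padic_mulV : {in padic_unit, left_inverse 1 padic_inv *%R}.
Proof.
move=> a /asboolP a_unit; rewrite /padic_inv.
by case: pselect => // ex; case: cid.
Qed.
Lemma padic_unitP (a b : Zp) : b * a = 1 -> padic_unit a.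
Proof. by move=> ba1; apply/asboolP; exists b. Qed.
Lemma padic_inv_out : {in [predC padic_unit], padic_inv =1 id}.
Proof.
move=> a /asboolP a_nunit; rewrite /padic_inv.
by case: pselect.
Qed.

HB.instance Definition _ := GRing.ComNzRing_hasMulInverse.Build Zp
  padic_mulV padic_unitP padic_inv_out.

Lemma residueS_mod (a : Zp) m n : (m <= n)%N -> (residue a n %% P m)%Z = residue a m.
Proof.
elim: n => [|n IHn]; first by rewrite leqn0 => /eqP->; rewrite residue_mod.
rewrite leq_eqVlt => /predU1P[-> | mn]; first exact: residue_mod.
by rewrite -IHn // (residueP a n) modz_modX.
Qed.

Lemma padic_neq0 (a : Zp) : a != 0 ->
  exists m, forall n, (m <= n)%N ->
    (0 < `|residue a n|)%N /\ (logn p `|residue a n| < m)%N.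
Proof.
move=> a0; have [m am0] : exists m, residue a m <> 0.
  apply: contra_notP (elimN eqP a0) => no; apply: padic_eqP => n /=.
  by rewrite mod0z; apply: contra_notP no => an0; exists n.
exists m => n mn.
have ndv : ~~ (p ^ m %| `|residue a n|)%N.
  apply/negP => dv; apply: am0; rewrite -(residueS_mod a mn).
  by apply/dvdz_mod0P; rewrite dvdzE abszX.
have an0 : (0 < `|residue a n|)%N.
  by case: posnP ndv => // ->; rewrite dvdn0.
by split=> //; rewrite ltnNge; apply: contra ndv => ?; rewrite pfactor_dvdn.
Qed.

Lemma padic_integral (a b : Zp) : a * b = 0 -> (a == 0) || (b == 0).
Proof.
move=> ab0; apply: contraT; rewrite negb_or => /andP[].
move=> /padic_neq0[m am] /padic_neq0[n bn].
have [a0 la] := am _ (leq_addr n m); have [b0 lb] := bn _ (leq_addl m n).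
have := congr1 (fun c : Zp => residue c (m + n)) ab0; rewrite /= mod0z.
move=> /dvdz_mod0P; rewrite dvdzE abszX abszM pfactor_dvdn ?muln_gt0 ?a0 // lognM //.
by rewrite leqNgt -addSn leq_add // ltnW.
Qed.

HB.instance Definition _ :=
  GRing.ComUnitRing_isIntegral.Build Zp padic_integral.

End PadicInt.

Definition padic_rat (p : nat) (p_pr : prime p) : fieldType :=
  {fraction padic_int p_pr}.

Section CyclotomicField.

(* Intended for K = Q_p(theta) with theta a primitive p-th root of unity; such
   a K is a splitting field of 'X^p - 1, so the splitting field structure is no
   restriction. *)
Variables (p : nat) (p_pr : prime p).
Variables (K : splittingFieldType (padic_rat p_pr)) (theta : K).
Local Notation Zp := (padic_int p_pr).

Definition padic_in (a : Zp) : K := (FracField.tofrac a)%:A.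

HB.instance Definition _ := GRing.RMorphism.copy padic_in
  (in_alg K \o @FracField.tofrac (padic_int p_pr)).

(* Z_p[theta] *)
Definition cyc_int_pred : {pred K} :=
  fun z => `[< exists q : {poly Zp}, z = (map_poly padic_in q).[theta] >].

Lemma cyc_int_closed : subring_closed cyc_int_pred.
Proof.
split=> [|_ _ /asboolP[q ->] /asboolP[r ->]|_ _ /asboolP[q ->] /asboolP[r ->]];
  apply/asboolP.
- by exists 1; rewrite rmorph1 hornerC.
- by exists (q - r); rewrite rmorphB hornerD hornerN.
- by exists (q * r); rewrite rmorphM hornerM.
Qed.

HB.instance Definition _ := GRing.isSubringClosed.Build K cyc_int_pred cyc_int_closed.

Record cyc_int := CycInt { cyc_val : K; _ : cyc_val \in cyc_int_pred }.

HB.instance Definition _ := [isSub for cyc_val].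
HB.instance Definition _ := [Choice of cyc_int by <:].
HB.instance Definition _ := [SubChoice_isSubComNzRing of cyc_int by <:].

Definition cyc_units : set K :=
  [set u | [/\ u != 0, u \in cyc_int_pred & u^-1 \in cyc_int_pred]].

Definition frac_ideal (m : int) : set K :=
  [set z | exists2 a, a \in cyc_int_pred & z = (theta - 1) ^ m * a].

Definition cyc_ideal (m : int) : {pred cyc_int} :=
  fun a => `[< frac_ideal m (val a) >].

Lemma cyc_ideal_closed m : zmod_closed (cyc_ideal m).
Proof.
split=> [|a b /asboolP[a' a'O aE] /asboolP[b' b'O bE]]; apply/asboolP.
  by exists 0; rewrite ?rpred0 // mulr0 raddf0.
by exists (a' - b'); rewrite ?rpredB // raddfB /= aE bE mulrBr.
Qed.

HB.instance Definition _ m :=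
  GRing.isZmodClosed.Build cyc_int (cyc_ideal m) (cyc_ideal_closed m).

(* The quotient of Z_p[theta] by (theta - 1)^m, for m >= 0. *)
Definition cyc_quot (m : int) : zmodType := {ideal_quot (cyc_ideal m)}.

(* sigma_i; it is unique when K = Q_p(theta), and takes the junk value 1 when
   i is not coprime to p. *)
Definition cyc_gal (i : int) : gal_of {:K} :=
  odflt 1%g [pick s in 'Gal({:K} / 1%AS)%g | s theta == theta ^ i].

(* S_i (a /\ b) *)
Definition wedge_form (i : int) (a b : K) : K :=
  cyc_gal i a * cyc_gal (1 - i) b - cyc_gal (1 - i) a * cyc_gal i b.

Definition ell : nat := (p - 3)./2.

(* Coordinates are numbered from 0: the coordinate x 0 i is the coefficient
   x_(i+1) of S_(i+2). A homomorphism on the exterior square of Z_p[theta] is given by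
   its values on the elements a /\ b. *)
Definition skel_form (x : 'rV[K]_ell) (a b : K) : K :=
  \sum_(i < ell) x 0 i * wedge_form i.+2%:Z a b.

(* The elements of the exterior square are the finite sums of a /\ b. *)
Definition skel_image (x : 'rV[K]_ell) : set K :=
  [set z | exists s : seq (cyc_int * cyc_int),
     z = \sum_(ab <- s) skel_form x (val ab.1) (val ab.2)].

Definition Gamma (m : int) : set 'rV[K]_ell :=
  [set x | (skel_image x `<=` frac_ideal (m - 1))%classic].

Definition Delta (m : int) : set 'rV[K]_ell := (Gamma m `\` Gamma (m + 1))%classic.

Definition rho (i : int) (u : K) : K := u^-1 * cyc_gal i u * cyc_gal (1 - i) u.

Definition skel_act (u : K) (phi : gal_of {:K}) (x : 'rV[K]_ell) : 'rV[K]_ell :=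
  \row_i ((rho i.+2%:Z u)^-1 * phi (x 0 i)).

Definition chi (tau : gal_of {:K}) (u : K) : K := u * (tau u)^-1.

Definition ker_chi (tau : gal_of {:K}) : set K :=
  [set u | cyc_units u /\ chi tau u = 1].

Definition Omega (omega : Zp) (tau : gal_of {:K}) (n i : nat) : set 'rV[K]_ell :=
  [set x | Delta n%:Z x /\ skel_act 1 tau x = padic_in (omega ^+ i) *: x].

Section SkeletonGroup.

Variables (n e : nat) (x : 'rV[K]_ell).

Definition skel_carrier := cyc_quot (n%:Z + e%:Z - 1).

(* For p >= 7, c = 2p - 8 <= n, e <= n - c and x in Delta_n, the element of K is
   in Z_p[theta] and its class does not depend on the representatives, so that
   the result depends on neither repr nor the default value of insubd. *)
Definition skel_mul (a b : skel_carrier) : skel_carrier :=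
  let a' := val (repr a) in let b' := val (repr b) in
  (\pi_skel_carrier (insubd (0 : cyc_int)
    (a' + b' + 2%:R^-1 * skel_form x a' b')))%qT.

(* The group generated by theta; theta has finite order, so natural exponents
   are enough. *)
Definition theta_pred : {pred cyc_int} :=
  fun z => `[< exists i : nat, val z = theta ^+ i >].

Record theta_group := ThetaGroup {
  theta_val : cyc_int;
  _ : theta_val \in theta_pred }.

HB.instance Definition _ := [isSub for theta_val].

Lemma theta_pred_mul (s t : theta_group) : val s * val t \in theta_pred.
Proof.
case: s t => [s sP] [t tP] /=; move: sP tP => /asboolP[i si] /asboolP[j tj].
by apply/asboolP; exists (i + j)%N; rewrite rmorphM /= exprD -si -tj.
Qed.

Definition theta_mul (s t : theta_group) : theta_group :=
  ThetaGroup (theta_pred_mul s t).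

Definition theta_act (s : theta_group) (a : skel_carrier) : skel_carrier :=
  (\pi_skel_carrier (val s * repr a))%qT.

(* The multiplication of C_(n,e)(x). When e = 0 the form S(x) vanishes modulo
   (theta - 1)^(n-1), so that C_(n,0)(x) is the same group for all x in Delta_n. *)
Definition sdskel_mul (g g' : skel_carrier * theta_group) :
    skel_carrier * theta_group :=
  (skel_mul g.1 (theta_act g.2 g'.1), theta_mul g.2 g'.2).

End SkeletonGroup.

End CyclotomicField.

Definition mul_isomorphic (A B : Type) (mulA : A -> A -> A) (mulB : B -> B -> B) :=
  exists f : A -> B, bijective f /\ {morph f : a b / mulA a b >-> mulB a b}.

(* Main.v *)
(* Write kap = theta - 1, with valuation 1. A pair (u, phi) carrying x to y modulo
   Gamma_(n+e) yields the isomorphism (a, s) |-> (u phi(a), phi(s)). Conversely, an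
   isomorphism respects the base groups: otherwise the non-central element
   kap^(N-2), N = n + e - 1, would be mapped to a central one. Being a morphism of class 2
   groups, it is then additive on O/p^N and compatible with the two forms, and it is
   multiplication by a unit composed with a Galois automorphism up to an error that
   the forms do not see.

   If x and y are eigenvectors of (1, tau) and (u, phi) carries x to y, comparing
   with the conjugate by tau shows that (tau(u)/u, 1) acts on y as omega^(j-i). As
   tau(u)/u is a 1-unit, a large p-power of it acts trivially, so i = j; averaging u
   over the powers of tau moves it into the kernel of chi, and a power of tau in phi
   is traded for a scalar. *)
From HB Require Import structures.
Require Import Defs.
From mathcomp Require Import all_boot all_order all_fingroup all_algebra all_solvable all_field.
From mathcomp Require Import generic_quotient ring_quotient fraction.
From mathcomp Require Import boolp classical_sets.
From mathcomp Require Import zify ring.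

Set Implicit Arguments.
Unset Strict Implicit.
Unset Printing Implicit Defensive.

Import Order.TTheory GRing.Theory Num.Theory.
Local Open Scope ring_scope.

(** The forms are only Z_p-linear: from a factor kap^k in one argument only powers of p can be
    pulled out, and p is a unit times kap^(p-1). An argument in kap^k therefore contributes only k -
    (p - 2) to the valuation of the value. Two inequalities, in which [n] is one less than in the
    theorem, absorb this loss. [p <= n] makes the forms well defined on the quotient and lets them
    raise the valuation of an argument by at least 2. [e + p <= n + 2] gives the base groups class
    at most 2 and hides errors in p^n from the forms. The arithmetic of Q_p(theta), including the
    existence of all Galois automorphisms, is built up from the fact that 1/p is not integral. *)

Lemma fraction_quotient (R : idomainType) (c : {fraction R}) :
  exists a b, b != 0 /\ c * FracField.tofrac b = FracField.tofrac a.
Proof.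
elim/quotW: c => r; exists (frac r).1, (frac r).2; split; first exact: denom_ratioP.
unlock FracField.tofrac; rewrite -[LHS]FracField.pi_mul.
have r0 := denom_ratioP r.
by apply/eqmodP/eqP; rewrite /= !numden_Ratio ?mulf_neq0 ?oner_neq0 // !mulr1 mulrC.
Qed.

(* The Baer correspondence: commutators in the group law [a + b + h (B a b)] are
   the values of [B], so that the group law determines [B] and the addition. *)
Lemma baer_isomorphism (Q : zmodType) (h : Q -> Q) (B B' : Q -> Q -> Q) (f : Q -> Q) :
  (forall a b, h (a + b) = h a + h b) -> (forall a, h a + h a = a) ->
  (forall a b c, B (a + b) c = B a c + B b c) -> (forall a b, B b a = - B a b) ->
  (forall a b c, B (B a b) c = 0) -> (forall a b, B' b a = - B' a b) ->
  (forall a b, f (a + b + h (B a b)) = f a + f b + h (B' (f a) (f b))) ->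
  (forall a b, f (a + b) = f a + f b) /\ (forall a b, f (B a b) = B' (f a) (f b)).
Proof.
move=> hD h2 BD BC B0 B'C fM.
have h0 : h 0 = 0 by apply: (addrI (h 0)); rewrite -hD !addr0.
have hN a : h (- a) = - h a by apply/eqP; rewrite -addr_eq0 -hD addNr h0.
have half a b : a + a = b -> a = h b by move=> <-; rewrite hD h2.
(* The symmetric parts of the two products cancel, and the two halves of [B'] add up. *)
have fswap a b : f (a + b + h (B a b)) - f (b + a + h (B b a)) = B' (f a) (f b).
  rewrite !fM (B'C (f a) (f b)) hN -[RHS]h2 opprB (addrC (f b)).
  by rewrite addrA -(addrA (f a + f b)) addrC addKr.
have fcent z c : B z c = 0 -> f (z + c) = f z + f c /\ B' (f z) (f c) = 0.
  move=> zc; have Bcz : B c z = 0 by rewrite BC zc oppr0.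
  have B'0 : B' (f z) (f c) = 0.
    by rewrite -fswap zc Bcz h0 !addr0 (addrC c) subrr.
  by split=> //; rewrite -[z + c]addr0 -h0 -zc fM B'0 h0 addr0.
have fB a b : f (B a b) = B' (f a) (f b).
  have <- := fswap a b; set z := B a b.
  have -> : a + b + h z = z + (b + a + h (B b a)).
    by rewrite (BC a b) hN -/z (addrC b) addrCA -{2}(h2 z) addrK.
  by rewrite (fcent _ _ (B0 _ _ _)).1 addrK.
split=> // a b; set z := B a b.
have Bh c : B (h z) c = 0.
  by rewrite (half (B (h z) c) 0) ?h0 // -BD h2 B0.
have fh : f (h z) = h (f z).
  by apply: half; rewrite -(fcent _ _ (Bh _)).1 h2.
(* Compute [f (h z + (a + b))] twice: [h z] is central, and the argument is also the product of [a]
   and [b]. *)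
apply: (addrI (f (h z))); rewrite -(fcent _ _ (Bh _)).1 (addrC (h z)) fM fh fB.
by rewrite addrC.
Qed.

(** * p-adic integers *)

Section PadicIntegers.

Variables (p : nat) (p_pr : prime p).
Local Notation Zp := (padic_int p_pr).
Implicit Types a b : Zp.

Lemma residue_natr m n : residue (m%:R : Zp) n = (m%:Z %% p%:Z ^+ n)%Z.
Proof.
elim: m => [|m IHm]; first by rewrite mulr0n /=.
by rewrite mulrSr /= IHm modzDm -PoszD addn1.
Qed.

Lemma residue0 a : residue a 0 = 0.
Proof. by rewrite (residueP a 0) expr0 modz1. Qed.

Lemma padic_dvdp a : residue a 1 = 0 -> exists b, a = p%:R * b.
Proof.
move=> a1; have p0 : p%:Z != 0 by rewrite eqz_nat -lt0n prime_gt0.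
have dva n : (p%:Z %| residue a n.+1)%Z.
  have := residueS_mod a (ltn0Sn n); rewrite a1 expr1 => /eqP.
  by move=> an; apply/dvdz_mod0P/eqP.
(* Division by p costs one digit, so the n-th residue of the quotient comes from the next residue of
   [a]. *)
have bP : padic_compat p (fun n => residue a n.+1 %/ p%:Z)%Z.
  move=> n; apply: (mulfI p0); rewrite mulrC divzK ?dva // (residueP a n.+1).
  rewrite -{1}(divzK (dva n.+1)) mulrC exprS; set q := (_ %/ _)%Z.
  rewrite {1}(divz_eq q (p%:Z ^+ n)) mulrDr mulrCA modzMDl modz_small //.
  have pn0 : p%:Z ^+ n != 0 by rewrite expf_neq0.
  have pp : 0 < p%:Z by rewrite ltz_nat prime_gt0.
  by rewrite ltr_pM2l // mulr_ge0 ?modz_ge0 ?ltz_pmod ?exprn_gt0 // ltW.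
exists (PadicInt p_pr bP); apply: padic_eqP => n.
case: n => [|n]; first by rewrite !residue0.
rewrite /= residue_natr modzMml mulrC -[LHS]residue_mod.
by rewrite (residueP a n.+1) modz_mod divzK // dva.
Qed.

Lemma padic_digit a : exists (m : nat) b, a = m%:R + p%:R * b.
Proof.
have p0 : p%:Z != 0 by rewrite eqz_nat -lt0n prime_gt0.
have r0 : 0 <= residue a 1.
  by rewrite -residue_mod modz_ge0 // expr1.
exists `|residue a 1|%N.
have [|b ab] := @padic_dvdp (a - `|residue a 1|%:R).
  by rewrite /= residue_natr gez0_abs // modzNm modzDmr subrr mod0z.
by exists b; rewrite -ab addrC subrK.
Qed.

Lemma padic_unit_exists a : residue a 1 <> 0 -> exists b, b * a = 1.
Proof.
move=> a1; have cop n : coprimez (residue a n.+1) (p%:Z ^+ n.+1).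
  apply: coprimezXr; rewrite coprimez_sym coprimezE prime_coprime //.
  have := residueS_mod a (ltn0Sn n); rewrite expr1 => am.
  by rewrite -[p in (p %| _)%N]absz_nat -dvdzE; apply/negP => /dvdz_mod0P; rewrite am.
have ex n : exists c, (c * residue a n.+1 = 1 %[mod p%:Z ^+ n.+1])%Z.
  have [[u v] /= uv] := coprimezP _ _ (cop n).
  by exists u; rewrite -uv addrC modzMDl.
pose f n : int := if n is n'.+1 then sval (cid (ex n')) else 0.
have fP n : (f n * residue a n = 1 %[mod p%:Z ^+ n])%Z.
  by case: n => [|n]; rewrite ?modz1 // /f; case: cid.
clearbody f => {ex}.
(* The inverses are chosen independently at each level; they are compatible because an inverse
   modulo p^n is unique. *)
have fc n : (f n.+1 %% p%:Z ^+ n = f n %% p%:Z ^+ n)%Z.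
  have := congr1 (fun x => x %% p%:Z ^+ n)%Z (fP n.+1).
  rewrite /= !modz_modX // => f1.
  rewrite -[f n.+1]mulr1 -modzMmr -(fP n) modzMmr mulrA (mulrAC _ (f n)).
  by rewrite (residueP a n) -modzMml modzMmr f1 modzMml mul1r.
exists (padic_reduce p_pr fc); apply: padic_eqP => n /=.
by rewrite modzMml fP.
Qed.

Lemma padic_neq0_unit a : a != 0 ->
  exists t b, a = p%:R ^+ t * b /\ exists c, c * b = 1.
Proof.
move=> a0; have [m am0] : exists m, residue a m <> 0.
  apply: contra_notP (elimN eqP a0) => no; apply: padic_eqP => n /=.
  by rewrite mod0z; apply: contra_notP no => an0; exists n.
(* The index of a nonzero residue bounds the valuation and drops by one when p is divided out. *)
elim: m a am0 {a0} => [|m IHm] a am0; first by rewrite residue0 in am0.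
have [a1|/eqP a1] := eqVneq (residue a 1) 0; last first.
  by exists 0%N, a; rewrite mul1r; split => //; apply: padic_unit_exists.
have [b ab] := padic_dvdp a1.
have [|t [c [bc cu]]] := IHm b.
  move=> bm; apply: am0.
  have := residueS_mod b (leqnSn m); rewrite bm => /dvdz_mod0P/dvdzP[q qE].
  by rewrite ab /= residue_natr modzMml qE mulrCA -exprS modzMl.
by exists t.+1, c; split => //; rewrite ab bc exprS mulrA.
Qed.

End PadicIntegers.

(** * The ring Z_p[theta] *)

Section CyclotomicIntegers.

Variables (p : nat) (p_pr : prime p).
Variables (K : splittingFieldType (padic_rat p_pr)) (theta : K).
Local Notation Zp := (padic_int p_pr).
Local Notation O := (cyc_int_pred theta).
Local Notation kap := (theta - 1).

(** Integral ideals as boolean predicates on K, so that the [rpred] lemmas apply without passing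
    through [cyc_int]. *)
Definition kap_pow (k : nat) : {pred K} := fun z => `[< frac_ideal theta k z >].
Local Notation I := kap_pow.

Lemma kap_powP k z : reflect (exists2 a, a \in O & z = kap ^+ k * a) (z \in I k).
Proof. exact: asboolP. Qed.

Lemma kap_pow_closed k : zmod_closed (I k).
Proof.
split=> [|a b /kap_powP[a' a'O ->] /kap_powP[b' b'O ->]]; apply/kap_powP.
  by exists 0; rewrite ?rpred0 // mulr0.
by exists (a' - b'); rewrite ?rpredB // mulrBr.
Qed.

HB.instance Definition _ k := GRing.isZmodClosed.Build K (I k) (kap_pow_closed k).

Lemma padic_in_int c : padic_in K c \in O.
Proof. by apply/asboolP; exists c%:P; rewrite map_polyC hornerC. Qed.

Lemma theta_int : theta \in O.
Proof. by apply/asboolP; exists 'X; rewrite map_polyX hornerX. Qed.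

Lemma kap_int : kap \in O.
Proof. by rewrite rpredB ?theta_int ?rpred1. Qed.

Lemma kap_pow0 z : (z \in I 0) = (z \in O).
Proof.
apply/kap_powP/idP => [[a aO ->]|zO]; first by rewrite mul1r.
by exists z; rewrite ?mul1r.
Qed.

Lemma kap_powM j k z w : z \in I j -> w \in I k -> z * w \in I (j + k).
Proof.
move=> /kap_powP[a aO ->] /kap_powP[b bO ->]; apply/kap_powP.
by exists (a * b); rewrite ?rpredM // exprD mulrACA.
Qed.

Lemma kap_powMl k z w : z \in O -> w \in I k -> z * w \in I k.
Proof. by rewrite -kap_pow0; apply: kap_powM. Qed.

Lemma kap_powMr k z w : z \in I k -> w \in O -> z * w \in I k.
Proof. by rewrite mulrC => zI wO; apply: kap_powMl. Qed.

Lemma kap_pow_id k : kap ^+ k \in I k.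
Proof. by apply/kap_powP; exists 1; rewrite ?rpred1 ?mulr1. Qed.

Lemma kap_powW j k z : (j <= k)%N -> z \in I k -> z \in I j.
Proof.
move=> /subnK <- /kap_powP[a aO ->]; rewrite exprD mulrAC mulrC.
by rewrite kap_powMr ?kap_pow_id // rpredM ?rpredX ?kap_int.
Qed.

Lemma kap_pow_int k z : z \in I k -> z \in O.
Proof. by rewrite -kap_pow0; apply: kap_powW. Qed.

Lemma cyc_units_int u : cyc_units theta u -> u \in O. Proof. by case. Qed.
Lemma cyc_units_intV u : cyc_units theta u -> u^-1 \in O. Proof. by case. Qed.
Lemma cyc_units_neq0 u : cyc_units theta u -> u != 0. Proof. by case. Qed.

Lemma cyc_units1 : cyc_units theta 1.
Proof. by split; rewrite ?invr1 ?oner_neq0 ?rpred1. Qed.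

Lemma cyc_unitsM u v : cyc_units theta u -> cyc_units theta v -> cyc_units theta (u * v).
Proof.
by move=> [u0 uO uVO] [v0 vO vVO]; split; rewrite ?mulf_neq0 ?invfM ?rpredM.
Qed.

Lemma cyc_unitsV u : cyc_units theta u -> cyc_units theta u^-1.
Proof. by move=> [u0 uO uVO]; split; rewrite ?invr_eq0 ?invrK. Qed.

Lemma cyc_unitsN u : cyc_units theta u -> cyc_units theta (- u).
Proof. by move=> [u0 uO uVO]; split; rewrite ?oppr_eq0 ?invrN ?rpredN. Qed.

Lemma cyc_unitsX u k : cyc_units theta u -> cyc_units theta (u ^+ k).
Proof.
by move=> uU; elim: k => [|k IHk]; rewrite ?exprS; [apply: cyc_units1 | apply: cyc_unitsM].
Qed.

Lemma cyc_units_prod (T : Type) (r : seq T) (P : pred T) (F : T -> K) :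
  (forall i, P i -> cyc_units theta (F i)) -> cyc_units theta (\prod_(i <- r | P i) F i).
Proof.
by move=> FU; elim/big_rec: _ => [|i z Pi zU]; [apply: cyc_units1 | apply: cyc_unitsM (FU i Pi) zU].
Qed.

Lemma kap_pow_unit k u z : cyc_units theta u -> (u * z \in I k) = (z \in I k).
Proof.
move=> [u0 uO uVO]; apply/idP/idP; last exact: kap_powMl.
by move=> /(kap_powMl uVO); rewrite mulKf.
Qed.

Lemma padic_in_inj : injective (padic_in K).
Proof.
move=> a b ab; apply/eqP; rewrite -tofrac_eq; apply/eqP.
exact: (fmorph_inj (GRing.in_alg K)) ab.
Qed.

Lemma natr_neq0 m : (0 < m)%N -> m%:R != 0 :> K.
Proof.
move=> m0; rewrite -(rmorph_nat (padic_in K)) -(rmorph0 (padic_in K)).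
apply/negP => /eqP/padic_in_inj/(congr1 (fun a => residue a m)).
rewrite residue_natr /= mod0z modz_small ?lez_nat //.
by move=> [m0']; rewrite m0' in m0.
by rewrite -rmorphXn /= ltz_nat ltn_expl ?prime_gt1.
Qed.

Hypothesis prim_theta : p.-primitive_root theta.

Lemma theta_neq0 : theta != 0.
Proof.
apply/eqP => t0; have /eqP := prim_expr_order prim_theta.
by rewrite t0 expr0n gtn_eqF ?prime_gt0 // eq_sym oner_eq0.
Qed.

Lemma kap_neq0 : kap != 0.
Proof.
by rewrite subr_eq0 -[theta]expr1 -(prim_order_dvd prim_theta) gtnNdvd ?prime_gt1.
Qed.

(** O is integral over Z_p, as theta is a root of X^p - 1. A monic equation for 1/p, multiplied by a
    power of p, would make 1 a multiple of p in Z_p. The strictness of the chain of ideals kap^k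
    rests on this. *)
Lemma pV_notin_int : (p%:R)^-1 \notin O.
Proof.
have p0 := natr_neq0 (prime_gt0 p_pr).
apply/negP => /asboolP[q qE].
have : integralOver (padic_in K) (p%:R^-1).
  rewrite qE; apply: integral_horner.
    by apply/integral_poly => i; rewrite coef_map; apply: integral_id.
  exists ('X^p - 1); first by rewrite monicXnsubC ?prime_gt0.
  rewrite rmorphB rmorph1 /= map_polyXn rootE !hornerE.
  by rewrite prim_expr_order // subrr.
move=> [r r_monic]; rewrite /root horner_coef size_map_poly_id0; last first.
  by rewrite (monicP r_monic) rmorph1 oner_neq0.
have := monic_neq0 r_monic; rewrite -size_poly_gt0.
have := monicP r_monic; rewrite lead_coefE.
case: (size r) => // m /= rm _ /eqP/(congr1 (fun z => z * p%:R ^+ m)).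
rewrite mul0r big_ord_recr /= coef_map /= rm rmorph1 mul1r mulrDl -exprMn mulVf // expr1n.
rewrite mulr_suml => sum0.
have : padic_in K (p%:R * (\sum_(i < m) r`_i * p%:R ^+ (m - i).-1) + 1) = padic_in K 0.
  rewrite rmorph0 -sum0 rmorphD rmorph1 rmorphM rmorph_sum mulr_sumr rmorph_nat.
  congr (_ + _); apply: eq_bigr => i _.
  rewrite rmorphM rmorphXn rmorph_nat coef_map /= mulrCA -mulrA -exprS prednK ?subn_gt0 //.
  by rewrite exprB ?unitfE 1?ltnW // exprVn [X in _ = _ * X]mulrC.
move/padic_in_inj/(congr1 (fun a => residue a 1%N)) => /=.
rewrite residue_natr !expr1 modzz mul0r !mod0z add0r modz_mod modz_small //.
by rewrite ler01 (ltz_nat 1) prime_gt1.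
Qed.

(** Cyclotomic units: with j inverse to i modulo p, theta is the j-th power of theta^i, so the
    inverse of the geometric sum is again a geometric sum. *)
Lemma kap_theta_exp i : coprime i p ->
  exists2 u, cyc_units theta u & theta ^+ i - 1 = kap * u.
Proof.
move=> ip; pose u := \sum_(j < i) theta ^+ j.
have uE : theta ^+ i - 1 = kap * u by rewrite subrX1.
exists u => //.
have ti0 : theta ^+ i - 1 != 0.
  rewrite subr_eq0 -(prim_order_dvd prim_theta) -prime_coprime //.
  by rewrite coprime_sym.
have u0 : u != 0 by apply: contraNneq ti0 => u0; rewrite uE u0 mulr0.
split=> //; first by rewrite rpred_sum // => j _; rewrite rpredX ?theta_int.
have i0 : (0 < i)%N.
  by case: i ip {u uE ti0 u0} => //; rewrite /coprime gcd0n => /eqP p1;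
    have := prime_gt1 p_pr; rewrite p1.
have [j [k jk]] : exists j k, (i * j = k * p + 1)%N.
  by case: (egcdnP p i0) => j k jk _; exists j, k; rewrite mulnC jk (eqP ip).
have : kap = (theta ^+ i - 1) * \sum_(l < j) (theta ^+ i) ^+ l.
  rewrite -subrX1 -exprM jk exprD (mulnC k) exprM (prim_expr_order prim_theta) expr1n.
  by rewrite mul1r expr1.
rewrite uE -mulrA -[X in X = _]mulr1 => /(mulfI kap_neq0) uV.
suff -> : u^-1 = \sum_(l < j) (theta ^+ i) ^+ l.
  by rewrite rpred_sum // => l _; rewrite !rpredX ?theta_int.
by apply: (mulfI u0); rewrite divff.
Qed.

(* Evaluate (X^p - 1) / (X - 1) at 1. *)
Lemma p_kap_unit : exists2 u, cyc_units theta u & p%:R = kap ^+ p.-1 * u.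
Proof.
have pp : p = p.-1.+1 by rewrite prednK ?prime_gt0.
have pE : \prod_(1 <= i < p) (1 - theta ^+ i) = p%:R.
  have := factor_Xn_sub_1 prim_theta.
  rewrite big_ltn ?prime_gt0 // expr0 subrX1.
  move=> /(mulfI (negbT (polyXsubC_eq0 _))) /(congr1 (fun q : {poly K} => q.[1])).
  rewrite horner_prod horner_sum.
  under eq_bigr do rewrite hornerXsubC.
  under [RHS]eq_bigr do rewrite hornerXn expr1n.
  by rewrite sumr_const card_ord.
have prodE m : (m < p)%N ->
    exists2 u, cyc_units theta u & \prod_(1 <= i < m.+1) (1 - theta ^+ i) = kap ^+ m * u.
  elim: m => [|m IHm] mp; first by exists 1; [apply: cyc_units1 | rewrite big_nil mulr1].
  have [u uU uE] := IHm (ltnW mp).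
  have [|v vU vE] := @kap_theta_exp m.+1.
    by rewrite coprime_sym prime_coprime // gtnNdvd.
  exists (u * - v); first by apply: cyc_unitsM; last apply: cyc_unitsN.
  rewrite big_nat_recr //= uE -(opprB (theta ^+ m.+1)) vE exprSr !mulrN; congr (- _); ring.
have [|u uU] := prodE p.-1; first by rewrite prednK ?prime_gt0.
by rewrite -pp pE => pu; exists u.
Qed.

Lemma natrp_int_pow q : p%:R ^+ q \in I (q * p.-1).
Proof.
have [u uU ->] := p_kap_unit; rewrite exprMn mulrC -exprM mulnC.
by rewrite (kap_pow_unit _ _ (cyc_unitsX _ uU)) kap_pow_id.
Qed.

Lemma kap_pow_natrp q r z : z \in I (q * p.-1 + r) -> exists2 w, w \in I r & z = p%:R ^+ q * w.
Proof.
have [u uU pu] := p_kap_unit; move=> /kap_powP[a aO ->].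
exists (kap ^+ r * ((u ^+ q)^-1 * a)).
  rewrite kap_powMr ?kap_pow_id // rpredM // cyc_units_intV //.
  exact: cyc_unitsX.
have U0 : u ^+ q != 0 by apply: cyc_units_neq0 (cyc_unitsX _ uU).
rewrite pu exprMn exprD mulnC exprM; set c := (_ ^+ q); set d := kap ^+ r; field.
exact: U0.
Qed.

Lemma kapV_notin_int : kap^-1 \notin O.
Proof.
have [u uU pu] := p_kap_unit.
apply: contra pV_notin_int => kV; rewrite pu invfM rpredM ?(cyc_units_intV uU) //.
by rewrite -exprVn rpredX.
Qed.

Lemma kap_powS_neq k : kap ^+ k \notin I k.+1.
Proof.
apply: contra kapV_notin_int => /kap_powP[a aO]; rewrite exprSr -mulrA.
rewrite -[LHS]mulr1 => /(mulfI (expf_neq0 _ kap_neq0)) ka.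
suff -> : kap^-1 = a by [].
by apply: (mulfI kap_neq0); rewrite divff ?kap_neq0.
Qed.

Lemma one_notin_kap_pow1 : 1 \notin I 1.
Proof. by rewrite -[1](expr0 kap) kap_powS_neq. Qed.

Lemma unit_notin_kap_pow1 u : cyc_units theta u -> u \notin I 1.
Proof. by move=> uU; rewrite -[u]mulr1 kap_pow_unit // one_notin_kap_pow1. Qed.

Lemma kap_powS_inv k z : kap * z \in I k.+1 -> z \in I k.
Proof.
move=> /kap_powP[a aO]; rewrite exprS -mulrA => /(mulfI kap_neq0) ->.
by apply/kap_powP; exists a.
Qed.

(** Nonzero elements of Q_p are powers of p up to units; two exponents avoid a negative one. Hence
    their valuations in K are multiples of p - 1. *)
Lemma scale1_int (c : padic_rat p_pr) : c%:A != 0 :> K ->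
  exists t1 t2 b, cyc_units theta b /\ (c%:A : K) * p%:R ^+ t1 = p%:R ^+ t2 * b.
Proof.
move=> c0; have [a1 [a2 [a20 cE]]] : exists a1 a2 : Zp,
    a2 != 0 /\ c%:A * padic_in K a2 = padic_in K a1.
  have [a1 [a2 [a20 cE]]] := fraction_quotient c; exists a1, a2; split => //.
  by rewrite /padic_in -cE -scalerAl mul1r scalerA.
have a10 : a1 != 0.
  apply/eqP => a10; move: cE => /eqP; rewrite a10 rmorph0 mulf_eq0 (negPf c0) /=.
  by rewrite -(rmorph0 (padic_in K)) => /eqP/padic_in_inj/eqP; apply/negP.
have [t2 [b1 [a1E [c1 c1b1]]]] := padic_neq0_unit a10.
have [t1 [b2 [a2E [c2 c2b2]]]] := padic_neq0_unit a20.
have unitZ b' c' : c' * b' = 1 -> cyc_units theta (padic_in K b').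
  move=> cb; have cbK : padic_in K c' * padic_in K b' = 1 by rewrite -rmorphM cb rmorph1.
  have b0 : padic_in K b' != 0 by apply: contra_eq_neq cbK => ->; rewrite mulr0 eq_sym oner_neq0.
  split; rewrite ?padic_in_int //.
  suff -> : (padic_in K b')^-1 = padic_in K c' by rewrite padic_in_int.
  by apply: (mulIf b0); rewrite mulVf.
exists t1, t2, (padic_in K b1 / padic_in K b2); split.
  by apply: cyc_unitsM; [apply: unitZ c1b1 | apply/cyc_unitsV/unitZ; exact: c2b2].
apply: (mulIf (cyc_units_neq0 (unitZ _ _ c2b2))).
rewrite -!mulrA mulVf ?(cyc_units_neq0 (unitZ _ _ c2b2)) // mulr1.
by rewrite mulrA; move: cE; rewrite a1E a2E !rmorphM !rmorphXn !rmorph_nat mulrA.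
Qed.

(** * Galois automorphisms of K *)

Hypothesis gen_theta : <<1%AS; theta>>%VS = {:K}%VS.

Lemma gal_theta (s : gal_of {:K}) : exists2 i, coprime i p & s theta = theta ^+ i.
Proof.
have /(prim_rootP prim_theta)[i si] : s theta ^+ p = 1.
  by rewrite -rmorphXn (prim_expr_order prim_theta) rmorph1.
exists i => //; rewrite coprime_sym prime_coprime //; apply/negP => /dvdnP[j ij].
have : s theta = s 1 by rewrite si ij mulnC exprM (prim_expr_order prim_theta) expr1n rmorph1.
move=> /fmorph_inj t1; have := kap_neq0; by rewrite t1 subrr eqxx.
Qed.

Lemma gal_scale1 (s : gal_of {:K}) (c : padic_rat p_pr) : s c%:A = c%:A.
Proof. by rewrite linearZ /= rmorph1. Qed.

Lemma gal_padic_in (s : gal_of {:K}) c : s (padic_in K c) = padic_in K c.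
Proof. exact: gal_scale1. Qed.

Lemma gal_int (s : gal_of {:K}) z : z \in O -> s z \in O.
Proof.
move=> /asboolP[q ->]; have [i _ si] := gal_theta s.
rewrite -horner_map /= -map_poly_comp si.
rewrite (eq_map_poly (g := padic_in K)) => [|c]; last exact: gal_padic_in.
rewrite rpred_horner ?rpredX ?theta_int //; apply/polyOverP => j.
by rewrite coef_map padic_in_int.
Qed.

Lemma gal_units (s : gal_of {:K}) u : cyc_units theta u -> cyc_units theta (s u).
Proof. by move=> [u0 uO uVO]; split; rewrite ?fmorph_eq0 -?fmorphV ?gal_int. Qed.

Lemma gal_kap (s : gal_of {:K}) : exists2 u, cyc_units theta u & s kap = kap * u.
Proof.
have [i ip si] := gal_theta s; have [u uU uE] := kap_theta_exp ip.
by exists u; rewrite // rmorphB rmorph1 /= si.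
Qed.

Lemma gal_kap_pow (s : gal_of {:K}) k z : z \in I k -> s z \in I k.
Proof.
move=> /kap_powP[a aO ->]; have [u uU uE] := gal_kap s.
rewrite rmorphM rmorphXn /= uE exprMn -mulrA mulrCA.
by rewrite kap_pow_unit ?kap_powMr ?kap_pow_id ?gal_int //; apply: cyc_unitsX.
Qed.

Lemma galois_theta : galois 1 {:K}.
Proof.
apply/splitting_galoisField; exists ('X^p - 1); split.
- by rewrite rpredB ?rpredX ?polyOverX ?rpred1.
- exact: separable_Xn_sub_1 (natr_neq0 (prime_gt0 p_pr)).
exists [seq theta ^+ i | i <- index_iota 0 p].
  by rewrite big_map (factor_Xn_sub_1 prim_theta) eqpxx.
apply/eqP; rewrite eqEsubv subvf /=.
set E := <<_ & _>>%VS; have : (<<1; theta>> <= E)%VS.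
  rewrite -adjoin_seq1 adjoin_seqSr // => z.
  rewrite inE => /eqP ->; apply/mapP; exists 1%N; rewrite ?expr1 //.
  by rewrite mem_index_iota prime_gt1.
by rewrite gen_theta.
Qed.

Lemma galNorm_scale1 z : exists c : padic_rat p_pr, galNorm 1 {:K} z = c%:A.
Proof. by apply/vlineP; rewrite mem_galNorm ?galois_theta ?memvf. Qed.

Lemma kap_exp_unit_inj j k u v : cyc_units theta u -> cyc_units theta v ->
  kap ^+ j * u = kap ^+ k * v -> j = k.
Proof.
wlog jk : j k u v / (j < k)%N => [hw uU vU uv|uU vU uv].
  case: (ltngtP j k) => // jk; first exact: hw uv.
  by apply/esym; apply: hw (esym uv).
have : kap ^+ j \in I j.+1.
  rewrite -(kap_pow_unit _ _ uU) mulrC uv mulrC kap_pow_unit //.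
  exact: kap_powW (kap_pow_id _).
by rewrite (negPf (kap_powS_neq _)).
Qed.

(* The norm of kap lies in Q_p, where valuations are multiples of p - 1. *)
Lemma card_gal_dvd : (p.-1 %| #|'Gal({:K} / 1%AS)%g|)%N.
Proof.
have exN : exists2 u, cyc_units theta u &
    galNorm 1 {:K} kap = kap ^+ #|'Gal({:K} / 1%AS)%g| * u.
  have ex (s : gal_of {:K}) : exists u, cyc_units theta u /\ s kap = kap * u.
    by have [u uU uE] := gal_kap s; exists u.
  have [f fP] := fin_all_exists ex.
  exists (\prod_(s in 'Gal({:K} / 1%AS)%g) f s).
    by apply: cyc_units_prod => s _; case: (fP s).
  rewrite /galNorm (eq_bigr (fun s => kap * f s)) => [|s _]; last by case: (fP s).
  by rewrite big_split prodr_const.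
have [u uU uE] := exN; have [c cE] := galNorm_scale1 kap.
have c0 : c%:A != 0 :> K.
  by rewrite -cE galNorm_eq0 kap_neq0.
have [t1 [t2 [b [bU bE]]]] := scale1_int c0.
have [v vU pv] := p_kap_unit.
move: bE; rewrite -cE uE pv !exprMn -!exprM => bE.
have /kap_exp_unit_inj dE : kap ^+ (#|'Gal({:K} / 1%AS)%g| + p.-1 * t1) * (u * v ^+ t1) =
    kap ^+ (p.-1 * t2) * (v ^+ t2 * b).
  by rewrite exprD mulrACA bE mulrA.
rewrite -(dvdn_addl _ (dvdn_mulr t1 (dvdnn p.-1))) dE ?dvdn_mulr //.
  by apply: cyc_unitsM (cyc_unitsX _ vU).
by apply: cyc_unitsM bU; apply: cyc_unitsX.
Qed.

(** The map s |-> s(theta) embeds the Galois group into p - 1 powers of theta, and the group has at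
    least p - 1 elements by [card_gal_dvd]. This takes the place of the irreducibility of the
    cyclotomic polynomial. *)
Lemma gal_theta_exists i : coprime i p ->
  exists2 s : gal_of {:K}, s \in 'Gal({:K} / 1%AS)%g & s theta = theta ^+ i.
Proof.
move=> ip; pose S1 := [seq s theta | s : gal_of {:K} in 'Gal({:K} / 1%AS)%g].
pose S2 := [seq theta ^+ j | j <- iota 1 p.-1].
have modp j : coprime j p -> theta ^+ j \in S2.
  move=> jp; apply/mapP; exists (j %% p)%N; last by rewrite (prim_expr_mod prim_theta).
  rewrite mem_iota add1n (prednK (prime_gt0 p_pr)) (ltn_pmod _ (prime_gt0 p_pr)) andbT lt0n.
  by rewrite -/(dvdn p j) -prime_coprime // coprime_sym.
have S1u : uniq S1.
  rewrite map_inj_in_uniq ?enum_uniq // => s t.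
  rewrite !mem_enum => sG tG st; apply/eqP.
  have := @gal_adjoin_eq _ K 1%AS theta; rewrite gen_theta => -> //.
  exact/eqP.
have S12 : {subset S1 <= S2}.
  by move=> _ /mapP[s _ ->]; have [j jp ->] := gal_theta s; apply: modp.
have szS : (size S2 <= size S1)%N.
  rewrite !size_map size_iota -cardE dvdn_leq ?cardG_gt0 //.
  exact: card_gal_dvd.
have [_ S1E] := uniq_min_size S1u S12 szS.
have := modp i ip; rewrite -S1E => /mapP[s sG si].
by exists s => //; rewrite -mem_enum.
Qed.

(** * The residue field and the units of O *)

Lemma natrp_kap_pow1 : p%:R \in I 1.
Proof.
have := natrp_int_pow 1; rewrite expr1 mul1n; apply: kap_powW.
by have := prime_gt1 p_pr; case: p => [|[]].
Qed.

Lemma natr_kap_pow1 m : (m%:R \in I 1) = (p %| m)%N.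
Proof.
apply/idP/idP => [mI|/dvdnP[k ->]]; last first.
  by rewrite natrM kap_powMl ?natrp_kap_pow1 ?rpred_nat.
rewrite -[(_ %| _)%N]negbK -prime_coprime // coprime_sym; apply/negP => mp.
have m0 : (0 < m)%N.
  by case: m mp {mI} => //; rewrite /coprime gcd0n => /eqP p1;
    have := prime_gt1 p_pr; rewrite p1.
have [a [b ab]] : exists a b, (a * m = b * p + 1)%N.
  by case: (egcdnP p m0) => a b ab _; exists a, b; rewrite ab (eqP mp).
have : 1 \in I 1.
  suff -> : 1 = a%:R * m%:R - b%:R * p%:R :> K.
    by rewrite rpredB // kap_powMl ?rpred_nat ?natrp_kap_pow1.
  by rewrite -!natrM ab natrD addrC addKr.
by rewrite (negPf one_notin_kap_pow1).
Qed.

Lemma theta_kap_pow1 : kap \in I 1.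
Proof. by have := kap_pow_id 1; rewrite expr1. Qed.

(** The residue field is F_p: theta is 1 modulo kap, and every p-adic integer is a natural number
    modulo p. *)
Lemma int_residue z : z \in O -> exists m : nat, z - m%:R \in I 1.
Proof.
move=> /asboolP[q ->]; elim/poly_ind: q => [|q c [m qm]].
  by exists 0%N; rewrite rmorph0 horner0 subrr rpred0.
have [m' [b ->]] := padic_digit c; exists (m + m')%N.
rewrite rmorphD rmorphM /= map_polyX map_polyC hornerMXaddC /=.
rewrite rmorphD rmorphM !rmorph_nat natrD.
set v := _.[theta] in qm *; set B := padic_in K b.
have -> : v * theta + (m'%:R + p%:R * B) - (m%:R + m'%:R) =
    v * kap + (v - m%:R) + B * p%:R by ring.
have vO : v \in O by apply/asboolP; exists q.
apply: rpredD; last by rewrite kap_powMl ?natrp_kap_pow1 ?padic_in_int.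
by apply: rpredD => //; rewrite kap_powMl ?theta_kap_pow1.
Qed.

Lemma gal_residue (s : gal_of {:K}) z : z \in O -> s z - z \in I 1.
Proof.
move=> /int_residue[m zm]; have := gal_kap_pow s zm.
rewrite rmorphB rmorph_nat => szm.
by have := rpredB szm zm; rewrite opprB addrA subrK.
Qed.

Lemma congr_prod (T : Type) (r : seq T) (P : pred T) (F G : T -> K) k :
  (forall i, P i -> [/\ F i \in O, G i \in O & F i - G i \in I k]) ->
  \prod_(i <- r | P i) F i - \prod_(i <- r | P i) G i \in I k.
Proof.
move=> FG; suff [] : [/\ \prod_(i <- r | P i) F i \in O, \prod_(i <- r | P i) G i \in O &
  \prod_(i <- r | P i) F i - \prod_(i <- r | P i) G i \in I k] by [].
elim/big_rec2: _ => [|i f g Pi [fO gO fg]]; first by rewrite subrr !rpred1 rpred0.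
have [FO GO FGi] := FG i Pi; split; rewrite ?rpredM //.
have -> : F i * g - G i * f = F i * (g - f) + f * (F i - G i) by ring.
by rewrite rpredD // kap_powMl // -opprB rpredN.
Qed.

Lemma scale1_kap_pow1 (c : padic_rat p_pr) : (c%:A : K) \in O -> (c%:A : K) \notin I 1 ->
  cyc_units theta (c%:A : K).
Proof.
move=> cO cI; have c0 : c%:A != 0 :> K by apply: contraNneq cI => ->; rewrite rpred0.
have [t1 [t2 [b [bU cE]]]] := scale1_int c0.
have pU := natr_neq0 (prime_gt0 p_pr).
have pI t z : z \in O -> (0 < t)%N -> p%:R ^+ t * z \in I 1.
  by case: t => // t zO _; rewrite exprS -mulrA kap_powMr ?natrp_kap_pow1 //
    rpredM // rpredX // rpred_nat.
case: (ltngtP t1 t2) => t12.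
- case/negP: cI; suff -> : c%:A = p%:R ^+ (t2 - t1) * b :> K.
    by rewrite pI ?subn_gt0 // cyc_units_int.
  by apply: (mulIf (expf_neq0 t1 pU)); rewrite cE mulrAC -exprD subnK // ltnW.
- case/negP: (unit_notin_kap_pow1 bU); suff -> : b = p%:R ^+ (t1 - t2) * c%:A.
    by rewrite pI ?subn_gt0.
  by apply: (mulfI (expf_neq0 t2 pU)); rewrite -cE mulrA -exprD subnKC 1?mulrC // ltnW.
- by move: cE; rewrite t12 mulrC => /(mulfI (expf_neq0 t2 pU)) ->.
Qed.

(* The norm of z is z times an integral element, lies in Q_p, and is nonzero modulo
   kap because Gal acts trivially on the residue field. *)
Lemma cyc_unitsE z : z \in O -> z \notin I 1 -> cyc_units theta z.
Proof.
move=> zO zI; have [m zm] := int_residue zO.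
have pm : ~~ (p %| m)%N.
  by apply: contra zI; rewrite -natr_kap_pow1 => mI; rewrite -[z](subrK m%:R) rpredD.
pose G := 'Gal({:K} / 1%AS)%g; pose w := \prod_(s in G | s != 1%g) s z.
have NE : galNorm 1 {:K} z = z * w.
  by rewrite /galNorm (bigD1 1%g) ?group1 //= gal_id.
have wO : w \in O by rewrite rpred_prod // => s _; rewrite gal_int.
have NO : z * w \in O by rewrite rpredM.
have NI1 : z * w \notin I 1.
  have : z * w - m%:R ^+ #|G| \in I 1.
    rewrite -NE -prodr_const; apply: congr_prod => s _; split; rewrite ?gal_int ?rpred_nat //.
    by have := gal_kap_pow s zm; rewrite rmorphB rmorph_nat.
  move=> NI; apply/negP => zwI; have := rpredB zwI NI.
  by rewrite opprB addrC subrK -natrX natr_kap_pow1 Euclid_dvdX // (negPf pm).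
have NU : cyc_units theta (z * w).
  move: NO NI1; rewrite -NE; have [c ->] := galNorm_scale1 z; exact: scale1_kap_pow1.
have [zw0 _ NVO] := NU; have /norP[z0 w0] : ~~ ((z == 0) || (w == 0)) by rewrite -mulf_eq0.
split=> //; suff -> : z^-1 = w * (z * w)^-1 by rewrite rpredM.
by rewrite invfM mulrCA mulfV // mulr1.
Qed.

Lemma natr_units m : ~~ (p %| m)%N -> cyc_units theta m%:R.
Proof. by move=> pm; apply: cyc_unitsE; rewrite ?rpred_nat ?natr_kap_pow1. Qed.

(** The cofactor of u - 1 in u^p - 1 is a sum of p terms congruent to 1, hence divisible by kap. *)
Lemma one_unit_expp k u : u \in O -> u - 1 \in I k.+1 -> u ^+ p - 1 \in I k.+2.
Proof.
move=> uO uI; rewrite subrX1 -addn1; apply: kap_powM => //.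
suff : \sum_(i < p) u ^+ i - \sum_(i < p) 1 \in I 1.
  rewrite sumr_const card_ord => h.
  by rewrite -[X in X \in _](subrK p%:R) rpredD // natrp_kap_pow1.
rewrite -sumrB rpred_sum // => i _; rewrite subrX1 kap_powMr ?(kap_powW _ uI) //.
by rewrite rpred_sum // => j _; rewrite rpredX.
Qed.

Lemma one_unit_exp_ppow k u : u \in O -> u - 1 \in I 1 -> u ^+ (p ^ k) - 1 \in I k.+1.
Proof.
move=> uO uI; elim: k => [|k IHk]; first by rewrite expn0 expr1.
by rewrite expnSr exprM; apply: one_unit_expp; rewrite ?rpredX.
Qed.

(** * Teichmüller representatives *)

Section Teichmuller.

Variable omega : Zp.
Hypothesis prim_omega : (p.-1).-primitive_root omega.
Local Notation w := (padic_in K omega).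

Lemma prim_padic_in : (p.-1).-primitive_root w.
Proof.
have /andP[p0 /forallP h] := prim_omega; apply/andP; split=> //.
apply/forallP => i; rewrite -(eqP (h i)) !unity_rootE -rmorphXn.
by rewrite -(rmorph1 (padic_in K)) (inj_eq padic_in_inj).
Qed.

Lemma omega_units a : cyc_units theta (w ^+ a).
Proof.
apply: cyc_unitsX; have w1 := prim_expr_order prim_padic_in.
have p1 : (0 < p.-1)%N by have := prime_gt1 p_pr; case: p => [|[]].
have w0 : w != 0.
  by apply: contra_eq_neq w1 => ->; rewrite expr0n gtn_eqF // eq_sym oner_neq0.
split; rewrite ?padic_in_int //.
suff -> : w^-1 = w ^+ p.-1.-1 by rewrite rpredX ?padic_in_int.
by apply: (mulfI w0); rewrite divff // -exprS prednK.
Qed.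

(** By Fermat u^(p-1) - 1 lies in the maximal ideal, and it is the product of the u - w^i; these
    cannot all be units. *)
Lemma teichmuller_exists u : cyc_units theta u -> exists a, u - w ^+ a \in I 1.
Proof.
move=> uU; have uO := cyc_units_int uU; have [m um] := int_residue uO.
have pm : coprime m p.
  rewrite coprime_sym prime_coprime //; apply: contra (unit_notin_kap_pow1 uU).
  by rewrite -natr_kap_pow1 => mI; rewrite -[u](subrK m%:R) rpredD.
have um1 : u ^+ p.-1 - 1 \in I 1.
  have -> : u ^+ p.-1 - 1 = (u ^+ p.-1 - m%:R ^+ p.-1) + (m%:R ^+ p.-1 - 1) by ring.
  apply: rpredD.
    rewrite subrXX kap_powMr // rpred_sum // => i _.
    by rewrite rpredM ?rpredX ?rpred_nat.
  have := Euler_exp_totient pm; rewrite totient_prime // => /eqP.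
  have m0 : (0 < m ^ p.-1)%N.
    rewrite expn_gt0; case: m pm {um} => //.
    by rewrite /coprime gcd0n => /eqP p1;
    have := prime_gt1 p_pr; rewrite p1.
  by rewrite eqn_mod_dvd // -natr_kap_pow1 natrB // natrX.
apply: contrapT => no; have := factor_Xn_sub_1 prim_padic_in.
move=> /(congr1 (fun q : {poly K} => q.[u])); rewrite horner_prod !hornerE => prodE.
have : cyc_units theta (\prod_(0 <= i < p.-1) ('X - (w ^+ i)%:P).[u]).
  apply: cyc_units_prod => i _; rewrite !hornerE; apply: cyc_unitsE.
    by rewrite rpredB // rpredX ?padic_in_int.
  by apply/negP => ui; apply: no; exists i.
by move/unit_notin_kap_pow1; rewrite prodE um1.
Qed.

(** If z = w^(b-a) were 1 modulo kap, its vanishing geometric sum would be congruent to p - 1, which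
    is prime to p. *)
Lemma omega_diff_units a b : (a < p.-1)%N -> (b < p.-1)%N -> a != b ->
  cyc_units theta (w ^+ a - w ^+ b).
Proof.
wlog ab : a b / (a < b)%N => [hw ap bp ab|_ bp _].
  case: (ltngtP a b) ab => // ab _; first by apply: hw; rewrite // ltn_eqF.
  by rewrite -opprB; apply/cyc_unitsN/hw; rewrite // ltn_eqF.
have -> : w ^+ a - w ^+ b = w ^+ a * (1 - w ^+ (b - a)).
  by rewrite mulrBr mulr1 -exprD subnKC // ltnW.
apply: cyc_unitsM (omega_units a) _; apply: cyc_unitsE.
  by rewrite rpredB ?rpred1 ?rpredX ?padic_in_int.
apply/negP; set z := w ^+ (b - a) => zI.
have z1 : z != 1.
  rewrite -(prim_order_dvd prim_padic_in) gtnNdvd ?subn_gt0 //.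
  exact: leq_ltn_trans (leq_subr _ _) bp.
have sum0 : \sum_(i < p.-1) z ^+ i = 0.
  apply: (mulfI (_ : z - 1 != 0)); rewrite ?subr_eq0 // mulr0 -subrX1.
  by rewrite -exprM mulnC exprM (prim_expr_order prim_padic_in) expr1n subrr.
have : (p.-1)%:R \in I 1.
  rewrite -[_%:R]subr0 -sum0 -[X in X%:R]card_ord -sumr_const -sumrB rpred_sum // => i _.
  rewrite -opprB subrX1 rpredN kap_powMr //; first by rewrite -opprB rpredN.
  by rewrite rpred_sum // => j _; rewrite !rpredX ?padic_in_int.
have p1 : (0 < p.-1)%N by have := prime_gt1 p_pr; case: p => [|[]].
by rewrite natr_kap_pow1 gtnNdvd // ltn_predL prime_gt0.
Qed.

End Teichmuller.

(** * Skeleton forms and the groups Gamma_m *)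

Local Notation S := (skel_form theta).

Lemma skel_formDl x a a' b : S x (a + a') b = S x a b + S x a' b.
Proof. by rewrite -big_split; apply: eq_bigr => i _; rewrite /wedge_form !rmorphD /=; ring. Qed.

Lemma skel_formC x a b : S x b a = - S x a b.
Proof. by rewrite -sumrN; apply: eq_bigr => i _; rewrite /wedge_form; ring. Qed.

Lemma skel_formxx x a : S x a a = 0.
Proof. by apply: big1 => i _; rewrite /wedge_form; ring. Qed.

Lemma skel_formDr x a b b' : S x a (b + b') = S x a b + S x a b'.
Proof. by rewrite skel_formC skel_formDl opprD -!(skel_formC x _ a). Qed.

Lemma skel_form0l x b : S x 0 b = 0.
Proof. by apply: (addrI (S x 0 b)); rewrite -skel_formDl !addr0. Qed.

Lemma skel_formNl x a b : S x (- a) b = - S x a b.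
Proof. by apply/eqP; rewrite -addr_eq0 -skel_formDl addNr skel_form0l. Qed.

Lemma skel_formNr x a b : S x a (- b) = - S x a b.
Proof. by rewrite skel_formC skel_formNl -skel_formC. Qed.

Lemma skel_form_scalel x c a b :
  (forall s : gal_of {:K}, s c = c) -> S x (c * a) b = c * S x a b.
Proof.
move=> cfix; rewrite mulr_sumr; apply: eq_bigr => i _.
by rewrite /wedge_form !rmorphM /= !cfix; ring.
Qed.

Lemma skel_formBx x y a b : S (x - y) a b = S x a b - S y a b.
Proof. by rewrite -sumrB; apply: eq_bigr => i _; rewrite !mxE; ring. Qed.

Lemma skel_formZx c x a b : S (c *: x) a b = c * S x a b.
Proof. by rewrite mulr_sumr; apply: eq_bigr => i _; rewrite !mxE mulrA. Qed.

Lemma mem_gal1 (s : gal_of {:K}) : s \in 'Gal({:K} / 1%AS)%g.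
Proof. by rewrite gal_kHom ?sub1v // k1AHom. Qed.

Lemma gal_eq_theta (s t : gal_of {:K}) : s theta = t theta -> s = t.
Proof.
move=> st; apply/eqP; have := @gal_adjoin_eq _ K 1%AS theta.
by rewrite gen_theta => -> //; rewrite ?mem_gal1 //; apply/eqP.
Qed.

Lemma gal_comm (s t : gal_of {:K}) z : s (t z) = t (s z).
Proof.
have <- : (t * s)%g z = s (t z) by rewrite galM ?memvf.
have -> : (t * s)%g = (s * t)%g.
  apply: gal_eq_theta; rewrite !galM ?memvf //.
  have [i _ si] := gal_theta s; have [j _ tj] := gal_theta t.
  by rewrite si tj !rmorphXn /= si tj -!exprM mulnC.
by rewrite galM ?memvf.
Qed.

(** Since sigma_i(u) sigma_(1-i)(u) = u rho_i(u), dividing the coordinates by rho_i(u) leaves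
    exactly one factor u: the action transports the form along a |-> u phi(a). *)
Lemma skel_form_act x u (phi : gal_of {:K}) a b : u != 0 ->
  S (skel_act theta u phi x) (u * phi a) (u * phi b) = u * phi (S x a b).
Proof.
move=> u0; rewrite rmorph_sum mulr_sumr; apply: eq_bigr => i _.
rewrite mxE rmorphM /rho /wedge_form rmorphB !rmorphM /= !(gal_comm phi).
have s0 (s : gal_of {:K}) : s u != 0 by rewrite fmorph_eq0.
by field; rewrite u0 !s0.
Qed.

Lemma skel_act_comp u v (phi psi : gal_of {:K}) x :
  skel_act theta u phi (skel_act theta v psi x) = skel_act theta (u * phi v) (psi * phi)%g x.
Proof.
apply/rowP => i; rewrite !mxE galM ?memvf // rmorphM fmorphV mulrA -invfM /=.
congr (_ ^-1 * _); rewrite /rho !rmorphM fmorphV /= !(gal_comm phi) invfM.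
by ring.
Qed.

Lemma skel_act_1 x : skel_act theta 1 1%g x = x.
Proof.
by apply/rowP => i; rewrite mxE gal_id /rho !rmorph1 invr1 !mulr1 invr1 mul1r.
Qed.

(** For c fixed by the Galois group rho_i(c) = c, so powers of omega can be moved between the unit
    and a scalar. *)
Lemma skel_act_const c phi x : c != 0 -> (forall s : gal_of {:K}, s c = c) ->
  skel_act theta c phi x = c^-1 *: skel_act theta 1 phi x.
Proof.
move=> c0 cfix; apply/rowP => i; rewrite !mxE /rho !cfix !rmorph1 invr1 !mulr1 invr1 mul1r.
by rewrite mulVf // mul1r.
Qed.

Lemma skel_actB u phi x y :
  skel_act theta u phi (x - y) = skel_act theta u phi x - skel_act theta u phi y.
Proof. by apply/rowP => i; rewrite !mxE rmorphB mulrBr. Qed.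

Lemma skel_actZ u phi c x :
  skel_act theta u phi (c *: x) = phi c *: skel_act theta u phi x.
Proof. by apply/rowP => i; rewrite !mxE rmorphM mulrCA. Qed.

(* For m = n - 1 this is membership in Gamma_n. *)
Definition skel_into (m : nat) (x : 'rV[K]_(ell p)) :=
  forall a b, a \in O -> b \in O -> S x a b \in I m.

Lemma GammaP m x : Gamma theta m.+1 x <-> skel_into m x.
Proof.
have mE : m.+1%:Z - 1 = m by rewrite -addn1 PoszD addrK.
split=> [xG a b aO bO|xm z [s ->]].
  rewrite unfold_in; apply/asboolP; rewrite -mE; apply: xG.
  by exists [:: (CycInt aO, CycInt bO)]; rewrite big_seq1.
have : \sum_(ab <- s) S x (val ab.1) (val ab.2) \in I m.
  by rewrite rpred_sum // => ab _; apply: xm; apply: valP.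
by rewrite mE => /asboolP.
Qed.

Lemma skel_intoW m m' x : (m' <= m)%N -> skel_into m x -> skel_into m' x.
Proof. by move=> mm xm a b aO bO; apply: kap_powW mm _; apply: xm. Qed.

Lemma skel_intoB m x y : skel_into m x -> skel_into m y -> skel_into m (x - y).
Proof. by move=> xm ym a b aO bO; rewrite skel_formBx rpredB ?xm ?ym. Qed.

Lemma skel_intoZ m c x : c \in O -> skel_into m x -> skel_into m (c *: x).
Proof. by move=> cO xm a b aO bO; rewrite skel_formZx kap_powMl ?xm. Qed.

Lemma act_surj u (phi : gal_of {:K}) a : cyc_units theta u -> a \in O ->
  exists2 a', a' \in O & a = u * phi a'.
Proof.
move=> [u0 uO uVO] aO; exists ((phi^-1)%g (u^-1 * a)); first by rewrite gal_int // rpredM.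
by rewrite -galM ?memvf // mulVg gal_id mulVKf.
Qed.

Lemma skel_into_act m u phi x : cyc_units theta u -> skel_into m x ->
  skel_into m (skel_act theta u phi x).
Proof.
move=> uU xm a b /(act_surj phi uU)[a' aO ->] /(act_surj phi uU)[b' bO ->].
rewrite skel_form_act ?cyc_units_neq0 // kap_powMl ?(cyc_units_int uU) //.
by rewrite gal_kap_pow ?xm.
Qed.

Lemma skel_form_natrp x q a b : S x (p%:R ^+ q * a) b = p%:R ^+ q * S x a b.
Proof. by rewrite skel_form_scalel // => s; rewrite rmorphXn rmorph_nat. Qed.

(* Only multiples of p pass through the form exactly; rounding the valuation k down
   to a multiple of p - 1 loses at most p - 2. *)
Lemma skel_form_kap_powl m x k z b : skel_into m x -> z \in I k -> b \in O ->
  S x z b \in I (k + m + 2 - p).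
Proof.
move=> xm zI bO.
have p1 : (0 < p.-1)%N by have := prime_gt1 p_pr; case: p => [|[]].
have := zI; rewrite {1}(divn_eq k p.-1) => /kap_pow_natrp[w wI ->].
rewrite skel_form_natrp; have := ltn_pmod k p1; have := divn_eq k p.-1.
set q := (k %/ _)%N => kE km.
apply: (@kap_powW _ (q * p.-1 + m)); last first.
  by apply: kap_powM (natrp_int_pow _) (xm _ _ (kap_pow_int wI) bO).
by lia.
Qed.

Lemma skel_form_kap_powr m x k z b : skel_into m x -> z \in I k -> b \in O ->
  S x b z \in I (k + m + 2 - p).
Proof. by move=> xm zI bO; rewrite skel_formC rpredN; apply: skel_form_kap_powl zI bO. Qed.

(** Substitute a = u a', b = u b' and expand with u = 1 + d: every remaining term contains d. The
    surplus p in the hypothesis pays for the loss in [skel_form_kap_powl] when d stands inside an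
    argument. *)
Lemma skel_act_one_unit m k x u : skel_into m x -> cyc_units theta u ->
  u - 1 \in I (k + p) -> skel_into k (skel_act theta u 1%g x - x).
Proof.
move=> xm uU uI a b aO bO.
have [a' a'O aE] := act_surj 1%g uU aO; have [b' b'O bE] := act_surj 1%g uU bO.
rewrite skel_formBx {1}aE {1}bE skel_form_act ?cyc_units_neq0 // gal_id aE bE !gal_id.
move: (subrK 1 u); set d := u - 1 in uI *; clearbody d => <-; rewrite (addrC d).
have dI z : z \in O -> d * z \in I (k + p) by move=> zO; rewrite kap_powMr.
rewrite !mulrDl !mul1r !(skel_formDl, skel_formDr).
have kp : (k <= k + p + m + 2 - p)%N by lia.
set s := S x a' b'.
rewrite [X in X \in _](_ : _ =
  d * s - S x a' (d * b') - S x (d * a') b' - S x (d * a') (d * b')); last by ring.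
have dO z : z \in O -> d * z \in O by move=> /dI /kap_pow_int.
rewrite !rpredB //.
- by apply: (@kap_powW _ (k + p)); rewrite ?leq_addr ?dI // (kap_pow_int (xm _ _ a'O b'O)).
- by apply: kap_powW kp _; apply: skel_form_kap_powr; rewrite ?dI.
- by apply: kap_powW kp _; apply: skel_form_kap_powl; rewrite ?dI.
- by apply: kap_powW kp _; apply: skel_form_kap_powl; rewrite ?dI ?dO.
Qed.

(** * Skeleton groups *)

Section SkeletonGroups.

(* [n] is one less than in the paper, so that Gamma_(n+1) has its images in p^n and
   the carrier is the quotient by p^N with N = n + e. *)
Variables (n e : nat).
Local Notation Q := (skel_carrier theta n.+1 e).
Local Notation N := (n + e)%N.
Implicit Types (a b : Q) (s t : theta_group theta).

Definition lift_quot a : K := val (repr a).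
(** Meaningful for z in O only; elsewhere [insubd] returns 0. *)
Definition proj_quot (z : K) : Q := (\pi_Q (insubd (0 : cyc_int theta) z))%qT.
Definition theta_elt s : K := val (val s).
Local Notation lf := lift_quot.
Local Notation pr := proj_quot.
Local Notation tv := theta_elt.

Lemma lift_int a : lf a \in O. Proof. exact: valP. Qed.

Lemma lift_quotK a : pr (lf a) = a.
Proof. by rewrite /pr /lf valKd reprK. Qed.

Lemma proj_eqP z w : z \in O -> w \in O -> reflect (pr z = pr w) (z - w \in I N).
Proof.
move=> zO wO; have NE : n.+1%:Z + e%:Z - 1 = N by rewrite -PoszD addSn -addn1 PoszD addrK.
have -> : (z - w \in I N) = (pr z == pr w).
  rewrite /proj_quot -Quotient.idealrBE.
  have -> : z - w = val (insubd (0 : cyc_int theta) z - insubd 0 w).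
    by rewrite raddfB /= !insubdK.
  by rewrite !unfold_in /cyc_ideal NE.
exact: eqP.
Qed.

Lemma proj_eq z w : z \in O -> w \in O -> z - w \in I N -> pr z = pr w.
Proof. by move=> zO wO /(proj_eqP zO wO). Qed.

Lemma proj_inj z w : pr z = pr w -> z \in O -> w \in O -> z - w \in I N.
Proof. by move=> zw zO wO; apply/proj_eqP. Qed.

Lemma lift_proj z : z \in O -> lf (pr z) - z \in I N.
Proof. by move=> zO; apply/proj_eqP; rewrite ?lift_int // lift_quotK. Qed.

Lemma proj_quotD z w : z \in O -> w \in O -> pr (z + w) = pr z + pr w.
Proof.
move=> zO wO; have piD (a b : cyc_int theta) : (\pi_Q (a + b) = \pi_Q a + \pi_Q b :> Q)%qT.
  exact: Quotient.pi_add.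
rewrite /proj_quot -piD; congr (\pi_Q _)%qT.
by apply: val_inj; rewrite raddfD /= !insubdK // rpredD.
Qed.

Lemma proj_quot0 : pr 0 = 0.
Proof. by apply: (addrI (pr 0)); rewrite -proj_quotD ?rpred0 // !addr0. Qed.

Lemma proj_quot_natr j z : z \in O -> pr (j%:R * z) = pr z *+ j.
Proof.
move=> zO; elim: j => [|j IHj]; first by rewrite mul0r proj_quot0.
by rewrite -(addn1 j) natrD mulrDl mul1r proj_quotD ?rpredM ?rpred_nat // IHj addn1 mulrSr.
Qed.

Lemma theta_elt_inj : injective tv.
Proof. by move=> s t st; apply/val_inj/val_inj. Qed.

Lemma theta_eltM s t : tv (theta_mul s t) = tv s * tv t.
Proof. exact: rmorphM. Qed.

Lemma theta_elt_exp s : tv s = 1 \/ exists2 i, coprime i p & tv s = theta ^+ i.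
Proof.
have /asboolP[i si] := valP s.
case: (boolP (p %| i)%N) => [/dvdnP[j ij]|pi]; [left | right].
  by rewrite /theta_elt si ij mulnC exprM (prim_expr_order prim_theta) expr1n.
by exists i; rewrite // coprime_sym prime_coprime.
Qed.

Lemma theta_elt_int s : tv s \in O. Proof. exact: valP. Qed.

Lemma theta_group_exists i : exists s, tv s = theta ^+ i.
Proof.
have tO : theta ^+ i \in O by rewrite rpredX ?theta_int.
have sP : CycInt tO \in @theta_pred p p_pr K theta by apply/asboolP; exists i.
by exists (ThetaGroup sP).
Qed.

Hypotheses (p_ge3 : (2 < p)%N) (p_le_n : (p <= n)%N).

Lemma half_int : 2%:R^-1 \in O.
Proof. by apply: cyc_units_intV; apply: natr_units; rewrite gtnNdvd. Qed.

Lemma half_double z : 2%:R^-1 * z + 2%:R^-1 * z = z :> K.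
Proof. by rewrite -mulrDr -mulr2n -[z *+ 2]mulr_natl mulKf // natr_neq0. Qed.

Section Form.

Variable x : 'rV[K]_(ell p).
Hypothesis xn : skel_into n x.

Lemma skel_form_int z w : z \in O -> w \in O -> S x z w \in O.
Proof. by move=> zO wO; apply: kap_pow_int (xn zO wO). Qed.

Lemma skel_mul_int z w : z \in O -> w \in O -> z + w + 2%:R^-1 * S x z w \in O.
Proof. by move=> zO wO; rewrite !rpredD // rpredM ?half_int ?skel_form_int. Qed.

Lemma skel_form_congr k z z' w w' : z' \in O -> w \in O ->
  z - z' \in I k -> w - w' \in I k -> S x z w - S x z' w' \in I (k + n + 2 - p).
Proof.
move=> z'O wO zz ww.
have -> : S x z w - S x z' w' = S x (z - z') w + S x z' (w - w').
  by rewrite skel_formDl skel_formNl skel_formDr skel_formNr; ring.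
apply: rpredD; first exact: (skel_form_kap_powl xn).
exact: (skel_form_kap_powr xn).
Qed.

(** Here [p <= n] outweighs the loss of at most p - 2, so the form descends to the quotient. *)
Lemma skel_form_congrN z z' w w' : z' \in O -> w \in O ->
  z - z' \in I N -> w - w' \in I N -> S x z w - S x z' w' \in I N.
Proof.
move=> z'O wO zz ww; apply: kap_powW (skel_form_congr z'O wO zz ww); lia.
Qed.

Lemma skel_mulE z w : z \in O -> w \in O ->
  skel_mul x (pr z) (pr w) = pr (z + w + 2%:R^-1 * S x z w).
Proof.
move=> zO wO; have -> : skel_mul x (pr z) (pr w) =
    pr (lf (pr z) + lf (pr w) + 2%:R^-1 * S x (lf (pr z)) (lf (pr w))) by [].
have lz := lift_proj zO; have lw := lift_proj wO.
apply: proj_eq; rewrite ?skel_mul_int ?lift_int //.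
rewrite [X in X \in _](_ : _ = (lf (pr z) - z) + (lf (pr w) - w) +
  2%:R^-1 * (S x (lf (pr z)) (lf (pr w)) - S x z w)); last by ring.
apply: rpredD (rpredD lz lw) _.
by rewrite kap_powMl ?half_int // skel_form_congrN ?lift_int.
Qed.

Lemma theta_actE s z : z \in O -> theta_act s (pr z) = pr (tv s * z).
Proof.
move=> zO; have -> : theta_act s (pr z) = pr (tv s * lf (pr z)).
  rewrite /theta_act /pr; congr (\pi_Q _)%qT; apply: val_inj.
  by rewrite /= insubdK ?rmorphM // rpredM ?theta_elt_int ?lift_int.
apply: proj_eq; rewrite ?rpredM ?theta_elt_int ?lift_int //.
by rewrite -mulrBr kap_powMl ?theta_elt_int ?lift_proj.
Qed.

Lemma sdskel_mulE z w s t : z \in O -> w \in O ->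
  sdskel_mul x (pr z, s) (pr w, t) =
  (pr (z + tv s * w + 2%:R^-1 * S x z (tv s * w)), theta_mul s t).
Proof.
by move=> zO wO; rewrite /sdskel_mul /= theta_actE // skel_mulE ?rpredM ?theta_elt_int.
Qed.

Definition quot_form a b := pr (S x (lf a) (lf b)).

Lemma quot_formE z w : z \in O -> w \in O -> quot_form (pr z) (pr w) = pr (S x z w).
Proof.
move=> zO wO; apply: proj_eq; rewrite ?skel_form_int ?lift_int //.
by apply: skel_form_congrN; rewrite ?lift_int ?lift_proj.
Qed.

Lemma skel_mul_quot a b : skel_mul x a b = a + b + pr (2%:R^-1 * lf (quot_form a b)).
Proof.
have fO := skel_form_int (lift_int a) (lift_int b).
have -> : a + b = pr (lf a + lf b) by rewrite proj_quotD ?lift_int // !lift_quotK.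
have -> : skel_mul x a b = pr (lf a + lf b + 2%:R^-1 * S x (lf a) (lf b)) by [].
rewrite -!proj_quotD ?rpredD ?rpredM ?half_int ?lift_int //.
have s1 := skel_mul_int (lift_int a) (lift_int b).
have s2 : lf a + lf b + 2%:R^-1 * lf (quot_form a b) \in O.
  by rewrite !rpredD ?rpredM ?half_int ?lift_int.
apply: (proj_eq s1 s2).
rewrite [X in X \in _](_ : _ =
  - (2%:R^-1 * (lf (quot_form a b) - S x (lf a) (lf b)))); last by ring.
by rewrite rpredN kap_powMl ?half_int ?lift_proj.
Qed.

Lemma quot_formDl a b c : quot_form (a + b) c = quot_form a c + quot_form b c.
Proof.
rewrite -(lift_quotK a) -(lift_quotK b) -(lift_quotK c) -proj_quotD ?lift_int //.
by rewrite !quot_formE ?rpredD ?lift_int // skel_formDl proj_quotD ?skel_form_int ?lift_int.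
Qed.

Lemma quot_formC a b : quot_form b a = - quot_form a b.
Proof.
apply/eqP; rewrite -addr_eq0 -proj_quotD ?skel_form_int ?lift_int //.
by rewrite skel_formC addNr proj_quot0.
Qed.

(** Values of the form lie in p^n, and applying the form once more reaches valuation 2n + 2 - p,
    which is at least N. *)
Lemma quot_form_nilp a b c : (e + p <= n + 2)%N -> quot_form (quot_form a b) c = 0.
Proof.
move=> ep; have aO := lift_int a; have bO := lift_int b.
have cO := lift_int c; have sO := skel_form_int aO bO.
have -> : quot_form (quot_form a b) c = pr (S x (S x (lf a) (lf b)) (lf c)).
  by rewrite -quot_formE // lift_quotK.
rewrite -proj_quot0; apply: proj_eq; rewrite ?rpred0 ?skel_form_int // subr0.
by apply: kap_powW (skel_form_kap_powl xn (xn aO bO) cO); lia.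
Qed.

End Form.

Lemma theta_group_one : exists s, tv s = 1.
Proof. exact: theta_group_exists 0%N. Qed.

Lemma skel_form_natrl x j z w : S x (j%:R * z) w = j%:R * S x z w.
Proof. by rewrite skel_form_scalel // => s; rewrite rmorph_nat. Qed.

Lemma skel_act_iso x y u (phi : gal_of {:K}) : skel_into n x -> skel_into n y ->
  cyc_units theta u -> skel_into N (skel_act theta u phi x - y) ->
  @mul_isomorphic (Q * theta_group theta) (Q * theta_group theta) (sdskel_mul x) (sdskel_mul y).
Proof.
move=> xn yn uU xy; have uO := cyc_units_int uU; have u0 := cyc_units_neq0 uU.
have th_ex (psi : gal_of {:K}) : exists T : theta_group theta -> theta_group theta,
    forall s, tv (T s) = psi (tv s).
  suff /choice[T TE] : forall s, exists t, tv t = psi (tv s) by exists T.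
  move=> s.
  have [i _ psiE] := gal_theta psi; have /asboolP[j sj] := valP s.
  have [t tE] := theta_group_exists (i * j); exists t.
  by rewrite tE /theta_elt sj rmorphXn /= psiE exprM.
pose tw (c : K) (psi : gal_of {:K}) a := pr (c * psi (lf a)).
have twE c psi z : c \in O -> z \in O -> tw c psi (pr z) = pr (c * psi z).
  move=> cO zO; apply: proj_eq; rewrite ?rpredM ?gal_int ?lift_int // -mulrBr -rmorphB.
  by rewrite kap_powMl // gal_kap_pow // lift_proj.
have twK c (psi : gal_of {:K}) c' (psi' : gal_of {:K}) :
    c \in O -> c' \in O -> c * psi c' = 1 -> (forall z, psi (psi' z) = z) ->
    cancel (tw c' psi') (tw c psi).
  move=> cO c'O cc psiK a; rewrite /(tw c') twE ?rpredM ?gal_int ?lift_int //.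
  by rewrite rmorphM /= psiK mulrA cc mul1r lift_quotK.
have phiV z : phi ((phi^-1)%g z) = z by rewrite -galM ?memvf // mulVg gal_id.
have phiK z : (phi^-1)%g (phi z) = z by rewrite -galM ?memvf // mulgV gal_id.
(* The unit part of the inverse of (u, phi) in the semidirect product. *)
have u'U : cyc_units theta ((phi^-1)%g u^-1) by apply: gal_units; apply: cyc_unitsV.
have u'O := cyc_units_int u'U.
have [T TE] := th_ex phi; have [T' T'E] := th_ex (phi^-1)%g.
exists (fun g => (tw u phi g.1, T g.2)); split.
  exists (fun g => (tw ((phi^-1)%g u^-1) (phi^-1)%g g.1, T' g.2)) => -[a s] /=; congr (_, _).
  - by apply: twK; rewrite // -rmorphM mulVf ?rmorph1.
  - by apply: theta_elt_inj; rewrite T'E TE phiK.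
  - by apply: twK; rewrite // phiV mulfV.
  - by apply: theta_elt_inj; rewrite TE T'E phiV.
move=> [a s] [b t]; rewrite -(lift_quotK a) -(lift_quotK b).
have aO := lift_int a; have bO := lift_int b; set z := lf a in aO *; set w := lf b in bO *.
have sO := theta_elt_int s; have swO : tv s * w \in O by rewrite rpredM.
rewrite sdskel_mulE //= !twE ?skel_mul_int // sdskel_mulE ?rpredM ?gal_int //.
congr (_, _); last by apply: theta_elt_inj; rewrite TE !theta_eltM !TE rmorphM.
have E : tv (T s) * (u * phi w) = u * phi (tv s * w) by rewrite TE rmorphM mulrCA.
rewrite E; apply: proj_eq.
- by rewrite rpredM ?gal_int ?skel_mul_int.
- by rewrite skel_mul_int ?rpredM ?gal_int.
have phizO : u * phi z \in O by rewrite rpredM ?gal_int.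
have phiwO : u * phi (tv s * w) \in O by rewrite rpredM ?gal_int.
have := xy _ _ phizO phiwO; rewrite skel_formBx skel_form_act // => h.
rewrite [X in X \in _](_ : _ = 2%:R^-1 * (u * phi (S x z (tv s * w)) -
  S y (u * phi z) (u * phi (tv s * w)))); first by rewrite kap_powMl ?half_int.
by rewrite !rmorphD !rmorphM fmorphV rmorph_nat; ring.
Qed.

(** * Isomorphisms respect the base groups *)

Section Isomorphism.

Variables x y : 'rV[K]_(ell p).
Hypotheses (xn : skel_into n x) (yn : skel_into n y).
Hypothesis e_gt0 : (0 < e)%N.
Variable F : Q * theta_group theta -> Q * theta_group theta.
Hypothesis F_inj : injective F.
Hypothesis F_morph : {morph F : g g' / sdskel_mul x g g' >-> sdskel_mul y g g'}.
Variable one : theta_group theta.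
Hypothesis oneE : tv one = 1.

Lemma theta_mul1 s : theta_mul s one = s.
Proof. by apply: theta_elt_inj; rewrite theta_eltM oneE mulr1. Qed.

Lemma theta_mulone s : theta_mul one s = s.
Proof. by apply: theta_elt_inj; rewrite theta_eltM oneE mul1r. Qed.

Lemma theta_mulC s t : theta_mul s t = theta_mul t s.
Proof. by apply: theta_elt_inj; rewrite !theta_eltM mulrC. Qed.

(** As the form is alternating, (j z, 1) is the j-th power of (z, 1); additivity of F is not yet
    available. *)
Lemma iso_theta_natr j z : z \in O ->
  tv (F (pr (j%:R * z), one)).2 = tv (F (pr z, one)).2 ^+ j.
Proof.
move=> zO; elim: j => [|j IHj].
  set g := F _; have : sdskel_mul y g g = g.
    rewrite /g -F_morph sdskel_mulE ?mul0r ?rpred0 // skel_form0l !mulr0 !addr0.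
    by rewrite theta_mul1.
  move=> /(congr1 (fun g => tv g.2)) /=; rewrite theta_eltM expr0.
  have t0 : tv g.2 != 0.
    by case: (theta_elt_exp g.2) => [->|[i _ ->]]; rewrite ?oner_neq0 ?expf_neq0 ?theta_neq0.
  by rewrite -[RHS]mulr1 => /(mulfI t0).
have jO : j%:R * z \in O by rewrite rpredM ?rpred_nat.
have -> : F (pr (j.+1%:R * z), one) = sdskel_mul y (F (pr (j%:R * z), one)) (F (pr z, one)).
  rewrite -F_morph sdskel_mulE // oneE mul1r skel_form_natrl skel_formxx !mulr0 addr0.
  by rewrite theta_mul1 -(addn1 j) natrD mulrDl mul1r.
by rewrite /= theta_eltM IHj exprSr.
Qed.

(* If (a, 1) were sent outside the base group, kap^(N - 2), which commutes with
   (a, 1), would be sent to a central element, whereas it is not central. *)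
Lemma iso_base a : (F (a, one)).2 = one.
Proof.
have p1 : (0 < p.-1)%N by lia.
(* The highest power of kap that theta does not fix modulo kap^N; since [p <= n], the form already
   vanishes on it. *)
pose z := kap ^+ (N - 2); have zO : z \in O by rewrite rpredX ?kap_int.
have zI : z \in I (N - 2) by apply: kap_pow_id.
(* As N - 2 >= p - 1, z is p times an integral element, and p-th powers in the group of theta are
   trivial. *)
have Fz : tv (F (pr z, one)).2 = 1.
  have zI' : z \in I (1 * p.-1 + (N - 2 - p.-1)) by apply: kap_powW zI; lia.
  have [z' /kap_pow_int z'O ->] := kap_pow_natrp zI'.
  rewrite expr1 iso_theta_natr //; move: (F _).2 => t.
  by case: (theta_elt_exp t) => [->|[i _ ->]]; rewrite ?expr1n //
    exprAC (prim_expr_order prim_theta) expr1n.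
have zcomm : sdskel_mul x (pr z, one) (a, one) = sdskel_mul x (a, one) (pr z, one).
  rewrite -(lift_quotK a) !sdskel_mulE ?lift_int // oneE !mul1r; congr (_, _).
  have sI w : w \in O -> S x z w \in I N.
    by move=> wO; apply: kap_powW (skel_form_kap_powl xn zI wO); lia.
  have aO := lift_int a; set v := lf a in aO *; have zvI := sI v aO.
  apply: proj_eq; rewrite ?skel_mul_int //.
  rewrite (skel_formC x z) [X in X \in _](_ : _ = S x z v) //.
  by rewrite -[RHS]half_double; ring.
apply: contrapT => Fa; case: (theta_elt_exp (F (a, one)).2) => [Fa1|[r rp tE]].
  by apply: Fa; apply: theta_elt_inj; rewrite Fa1.
have [u uU uE] := kap_theta_exp rp.
set b := (F (a, one)).1; set s := (F (a, one)).2 in tE Fa.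
set w := lf (F (pr z, one)).1.
have wO : w \in O := lift_int _; have bO : lf b \in O := lift_int _.
have Fzw : F (pr z, one) = (pr w, one).
  rewrite /w lift_quotK [LHS]surjective_pairing; congr (_, _).
  by apply: theta_elt_inj; rewrite Fz.
have sO : tv s \in O by apply: theta_elt_int.
(* Commuting with (b, s) expresses (s - 1) w by values of the form at w. The form raises the
   valuation of w by at least 2 and s - 1 costs only 1, so the valuation climbs until the modulus
   kap^N stops it. *)
have wI k : (k <= N - 1)%N -> w \in I k.
  have comm : (tv s - 1) * w - 2%:R^-1 * (S y w (lf b) - S y (lf b) (tv s * w)) \in I N.
    have := congr1 F zcomm; rewrite !F_morph Fzw.
    have -> : F (a, one) = (pr (lf b), s) by rewrite lift_quotK -surjective_pairing.
    rewrite !sdskel_mulE // oneE mul1r => -[/esym/proj_inj comm _].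
    have swO : tv s * w \in O by rewrite rpredM.
    rewrite [X in X \in _](_ : _ = lf b + tv s * w + 2%:R^-1 * S y (lf b) (tv s * w) -
      (w + lf b + 2%:R^-1 * S y w (lf b))); last by ring.
    exact: comm (skel_mul_int yn bO swO) (skel_mul_int yn wO bO).
  elim: k => [|k IHk] kN; first by rewrite kap_pow0.
  have wk := IHk (ltnW kN); rewrite -(kap_pow_unit _ _ uU); apply: kap_powS_inv.
  rewrite mulrA -uE -tE.
  rewrite -[_ * w](subrK (2%:R^-1 * (S y w (lf b) - S y (lf b) (tv s * w)))).
  apply: rpredD; first by apply: kap_powW comm; lia.
  rewrite kap_powMl ?half_int //; apply: rpredB.
    by apply: kap_powW (skel_form_kap_powl yn wk bO); lia.
  by apply: kap_powW (skel_form_kap_powr yn (kap_powMl sO wk) bO); lia.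
have wI1 := wI _ (leqnn _).
have wcentral g : sdskel_mul y (pr w, one) g = sdskel_mul y g (pr w, one).
  case: g => c t; rewrite -(lift_quotK c) !sdskel_mulE ?lift_int // oneE !mul1r.
  rewrite theta_mulC; congr (_, _).
  have cO := lift_int c; set v := lf c in cO *; have tO := theta_elt_int t.
  apply: proj_eq; rewrite ?skel_mul_int ?rpredM //.
  rewrite [X in X \in _](_ : _ =
    2%:R^-1 * (S y w v - S y v (tv t * w)) - (tv t - 1) * w); last by ring.
  apply: rpredB.
    rewrite kap_powMl ?half_int //; apply: rpredB.
      by apply: kap_powW (skel_form_kap_powl yn wI1 cO); lia.
    by apply: kap_powW (skel_form_kap_powr yn (kap_powMl tO wI1) cO); lia.
  have tI : tv t - 1 \in I 1.
    case: (theta_elt_exp t) => [->|[i ip ->]]; first by rewrite subrr rpred0.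
    have [u' u'U ->] := kap_theta_exp ip.
    by rewrite kap_powMr ?theta_kap_pow1 ?cyc_units_int.
  by apply: (@kap_powW _ (1 + (N - 1))); [lia | apply: kap_powM].
(* Pulled back along F, centrality would make z commute with theta, but z - theta z = -kap^(N-1). *)
have [th thE] := theta_group_exists 1; rewrite expr1 in thE.
have := wcentral (F (pr 0, th)); rewrite -Fzw -!F_morph => /F_inj.
rewrite !sdskel_mulE ?rpred0 // oneE mul1r skel_form0l skel_formC skel_form0l.
rewrite !(oppr0, mulr0, addr0, add0r).
rewrite thE => -[/proj_inj]; rewrite rpredM ?theta_int // zO => /(_ isT isT) + _.
have -> : z - theta * z = - kap ^+ (N - 1).
  by rewrite /z (_ : N - 1 = (N - 2).+1)%N ?exprS; [ring | lia].
rewrite rpredN => /(kap_powW (_ : (N - 1).+1 <= N)%N) => h.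
by have := kap_powS_neq (N - 1); rewrite h //; lia.
Qed.

End Isomorphism.

(* By the Baer correspondence an isomorphism restricts to an additive map f of the
   base groups with f (S x a b) = S y (f a) (f b). It is semilinear for some phi up
   to commutators, which lie in p^n, so f z = u * phi z modulo p^n with u = f 1; on
   p^n, which consists of multiples of a large power of p, the congruence holds
   modulo p^N by additivity. *)
Lemma skel_iso_act x y (F : Q * theta_group theta -> Q * theta_group theta) :
  skel_into n x -> skel_into n y -> (0 < e)%N -> (e + p <= n + 2)%N ->
  bijective F -> {morph F : g g' / sdskel_mul x g g' >-> sdskel_mul y g g'} ->
  exists u phi, cyc_units theta u /\ skel_into N (skel_act theta u phi x - y).
Proof.
move=> xn yn e_gt0 ep F_bij F_morph; have F_inj := bij_inj F_bij.
have [G FK GK] := F_bij.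
have G_morph : {morph G : g g' / sdskel_mul y g g' >-> sdskel_mul x g g'}.
  by move=> g g'; apply: F_inj; rewrite F_morph !GK.
have [one oneE] := theta_group_one.
pose f a := (F (a, one)).1.
have fE a : F (a, one) = (f a, one).
  by rewrite [LHS]surjective_pairing (iso_base xn yn e_gt0 F_inj F_morph).
have G_base := iso_base yn xn e_gt0 (can_inj GK) G_morph oneE.
have [th thE] := theta_group_exists 1; rewrite expr1 in thE.
have act1 a : theta_act one a = a.
  by rewrite -(lift_quotK a) theta_actE ?lift_int // oneE mul1r.
have fM a b : f (skel_mul x a b) = skel_mul y (f a) (f b).
  have := F_morph (a, one) (b, one); rewrite !fE /sdskel_mul /= !act1 (theta_mul1 oneE).
  by rewrite fE => -[].
have [fD fB] : (forall a b, f (a + b) = f a + f b) /\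
    (forall a b, f (quot_form x a b) = quot_form y (f a) (f b)).
  apply: (@baer_isomorphism _ (fun a => pr (2%:R^-1 * lf a))).
  - move=> a b; rewrite -proj_quotD ?rpredM ?half_int ?lift_int // -mulrDr.
    have abO : lf a + lf b \in O by rewrite rpredD ?lift_int.
    apply: proj_eq; [by rewrite rpredM ?half_int ?lift_int | by rewrite rpredM ?half_int |].
    rewrite -mulrBr kap_powMl ?half_int //; apply: proj_inj; rewrite ?lift_int //.
    by rewrite proj_quotD ?lift_int // !lift_quotK.
  - move=> a; rewrite -proj_quotD ?rpredM ?half_int ?lift_int // half_double.
    exact: lift_quotK.
  - by move=> *; apply: quot_formDl.
  - by move=> *; apply: quot_formC.
  - by move=> *; apply: quot_form_nilp.
  - by move=> *; apply: quot_formC.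
  - by move=> a b; rewrite -!skel_mul_quot.
have fMn a j : f (a *+ j) = f a *+ j.
  elim: j => [|j IHj]; last by rewrite !mulrSr fD IHj.
  by rewrite !mulr0n; apply: (addrI (f 0)); rewrite -fD !addr0.
pose g z := lf (f (pr z)).
have gO z : g z \in O by apply: lift_int.
have gK z : pr (g z) = f (pr z) by apply: lift_quotK.
have gD z w : z \in O -> w \in O -> g (z + w) - (g z + g w) \in I N.
  move=> zO wO; apply: proj_inj; rewrite ?rpredD //.
  by rewrite proj_quotD // !gK proj_quotD // fD.
have gMn j z : z \in O -> g (j%:R * z) - j%:R * g z \in I N.
  move=> zO; apply: proj_inj; rewrite ?rpredM ?rpred_nat //.
  by rewrite proj_quot_natr // !gK proj_quot_natr // fMn.
have nN : (n <= N)%N by apply: leq_addr.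
set a0 := (F (pr 0, th)).1; set s0 := (F (pr 0, th)).2.
have F0 : F (pr 0, th) = (pr (lf a0), s0) by rewrite lift_quotK -surjective_pairing.
have a0O : lf a0 \in O := lift_int a0; have s0O := theta_elt_int s0.
(* If (0, theta) went into the base group, the inverse isomorphism, which preserves base groups,
   would force theta = 1. *)
have [s01|[r rp s0E]] := theta_elt_exp s0.
  have := G_base a0; rewrite (_ : (a0, one) = F (pr 0, th)); last first.
    rewrite [RHS]surjective_pairing; congr (_, _).
    by apply: theta_elt_inj; rewrite oneE.
  rewrite FK => /(congr1 tv) /eqP; rewrite /= thE oneE -subr_eq0.
  by rewrite (negPf kap_neq0).
have [phi _ phiE] := gal_theta_exists rp.
(* Apply F to (theta z, 1)(0, theta) = (0, theta)(z, 1). The image of (0, theta) acts on the base as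
   theta^r up to values of the form, which lie in p^n. *)
have gtheta z : z \in O -> g (theta * z) - theta ^+ r * g z \in I n.
  move=> zO; have tzO : theta * z \in O by rewrite rpredM ?theta_int.
  have := F_morph (pr 0, th) (pr z, one); have := F_morph (pr (theta * z), one) (pr 0, th).
  rewrite !sdskel_mulE ?rpred0 // !thE !mulr0 skel_form0l skel_formC skel_form0l.
  rewrite !(oppr0, mulr0, addr0, add0r) (theta_mul1 oneE) (theta_mulone oneE) => ->.
  rewrite !fE -!gK F0 !sdskel_mulE // oneE mul1r s0E => -[/proj_inj h _].
  have rO : theta ^+ r * g z \in O by rewrite rpredM ?rpredX ?theta_int.
  have {}h := kap_powW nN (h (skel_mul_int yn (gO _) a0O) (skel_mul_int yn a0O rO)).
  rewrite [X in X \in _](_ : _ = (g (theta * z) + lf a0 + 2%:R^-1 * S y (g (theta * z)) (lf a0) -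
    (lf a0 + theta ^+ r * g z + 2%:R^-1 * S y (lf a0) (theta ^+ r * g z))) -
    2%:R^-1 * (S y (g (theta * z)) (lf a0) - S y (lf a0) (theta ^+ r * g z))); last by ring.
  by apply: rpredB h _; rewrite kap_powMl ?half_int // rpredB ?yn.
set u := g 1; have uO : u \in O by apply: gO.
(* With z = m + kap z', the error at z is phi(kap) times the error at z', modulo kap^(k+1). *)
have gphi k z : (k <= n)%N -> z \in O -> g z - u * phi z \in I k.
  elim: k z => [|k IHk] z kn zO; first by rewrite kap_pow0 rpredB // rpredM ?gal_int.
  have [m /kap_powP[z' z'O]] := int_residue zO; rewrite expr1 => zE.
  have {zE}-> : z = m%:R * 1 + (theta * z' + - z') by rewrite mulr1 -[LHS](subrK m%:R) zE; ring.
  have tz'O : theta * z' \in O by rewrite rpredM ?theta_int.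
  have dO : theta * z' - z' \in O by rewrite rpredB.
  have kN : (k.+1 <= N)%N by apply: leq_trans kn nN.
  have h1 : g (m%:R * 1 + (theta * z' - z')) - (g (m%:R * 1) + g (theta * z' - z')) \in I k.+1.
    by apply: kap_powW kN _; apply: gD; rewrite ?rpredM ?rpred_nat ?rpred1.
  have h2 := kap_powW kN (gMn m 1 (rpred1 _)).
  have h3 : g (theta * z') - (g (theta * z' - z') + g z') \in I k.+1.
    by apply: kap_powW kN _; rewrite -{1}[theta * z'](subrK z') gD.
  have h4 := kap_powW kn (gtheta z' z'O).
  have h5 : phi kap * (g z' - u * phi z') \in I k.+1.
    have [v vU ->] := gal_kap phi; rewrite -mulrA -add1n; apply: kap_powM theta_kap_pow1 _.
    by rewrite kap_pow_unit // IHk // ltnW.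
  move: h5; rewrite !rmorphD !rmorphM !rmorphN !rmorph1 rmorph_nat /= phiE => h5.
  rewrite [X in X \in _](_ : _ =
    (g (m%:R * 1 + (theta * z' - z')) - (g (m%:R * 1) + g (theta * z' - z')))
    + (g (m%:R * 1) - m%:R * g 1) - (g (theta * z') - (g (theta * z' - z') + g z'))
    + (g (theta * z') - theta ^+ r * g z') + (theta ^+ r - 1) * (g z' - u * phi z')); last first.
    by rewrite /u; ring.
  by rewrite rpredD // rpredD // rpredB // rpredD.
have uU : cyc_units theta u.
  apply: cyc_unitsE => //; apply/negP => uI.
  have [a aE] : exists a, f a = pr 1.
    exists (G (pr 1, one)).1; suff : F ((G (pr 1, one)).1, one) = (pr 1, one) by rewrite fE => -[].
    by rewrite -{2}(G_base (pr 1)) -surjective_pairing GK.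
  have := gphi 1%N (lf a) _ (lift_int a); rewrite /g lift_quotK aE.
  have l1 : lf (pr 1) - 1 \in I 1.
    by apply: (@kap_powW _ N); [lia | apply: lift_proj; rewrite rpred1].
  move=> h; have {}h : lf (pr 1) - u * phi (lf a) \in I 1 by apply: h; lia.
  have : 1 \in I 1.
    have -> : 1 = (lf (pr 1) - u * phi (lf a)) - (lf (pr 1) - 1) + u * phi (lf a) by ring.
    apply: rpredD; first exact: rpredB h l1.
    by rewrite kap_powMr // gal_int ?lift_int.
  by rewrite (negPf one_notin_kap_pow1).
(* The rounding leaves q (p - 1) >= n - (p - 2) >= e, so the factor p^q lifts precision n to N. *)
have gn v : v \in I n -> g v - u * phi v \in I N.
  have p1 : (0 < p.-1)%N by lia.
  have := divn_eq n p.-1; have := ltn_pmod n p1; set q := (n %/ _)%N => rl nE.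
  rewrite {1}nE => /kap_pow_natrp[v' /kap_pow_int v'O ->].
  have h1 := gMn (p ^ q)%N v' v'O; rewrite natrX in h1.
  have h2 : p%:R ^+ q * (g v' - u * phi v') \in I N.
    apply: (@kap_powW _ (q * p.-1 + n)); first by lia.
    by apply: kap_powM (natrp_int_pow _) (gphi _ _ _ _).
  rewrite rmorphM rmorphXn rmorph_nat /=.
  rewrite [X in X \in _](_ : _ = (g (p%:R ^+ q * v') - p%:R ^+ q * g v') +
    p%:R ^+ q * (g v' - u * phi v')); last by ring.
  exact: rpredD h1 h2.
exists u, phi; split=> // a b /(act_surj phi uU)[a' aO ->] /(act_surj phi uU)[b' bO ->].
rewrite skel_formBx skel_form_act ?cyc_units_neq0 //.
have sI := xn a' b' aO bO; have sO := kap_pow_int sI.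
have fS : g (S x a' b') - S y (g a') (g b') \in I N.
  apply: proj_inj; rewrite ?skel_form_int //.
  by rewrite gK -!quot_formE // fB !gK.
have gS : S y (g a') (g b') - S y (u * phi a') (u * phi b') \in I N.
  apply: (@kap_powW _ (n + n + 2 - p)); first lia.
  by apply: skel_form_congr; rewrite ?gphi // rpredM ?gal_int.
have := gn _ sI; set A := u * phi _; set B := S y (u * _) _ in gS * => h.
rewrite [X in X \in _](_ : _ = (g (S x a' b') - S y (g a') (g b')) +
  (S y (g a') (g b') - B) - (g (S x a' b') - A)); last by ring.
exact: rpredB (rpredD fS gS) h.
Qed.

End SkeletonGroups.

(** * Eigenvectors of (1, tau) *)

Section NormalForm.

Variable omega : Zp.
Hypothesis prim_omega : (p.-1).-primitive_root omega.
Local Notation w := (padic_in K omega).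
Local Notation A := (skel_act theta).

Lemma scale_skel_act c u (phi : gal_of {:K}) x : c != 0 -> (forall s : gal_of {:K}, s c = c) ->
  c *: A u phi x = A (c^-1 * u) phi x.
Proof.
move=> c0 cfix; have cV (s : gal_of {:K}) : s c^-1 = c^-1 by rewrite fmorphV /= cfix.
have -> : A (c^-1 * u) phi x = A c^-1 1%g (A u phi x).
  by rewrite skel_act_comp gal_id mulg1.
by rewrite [RHS]skel_act_const ?invr_eq0 // invrK skel_act_1.
Qed.

Lemma gal_omega (s : gal_of {:K}) a : s (w ^+ a) = w ^+ a.
Proof. by rewrite rmorphXn /= gal_padic_in. Qed.

Lemma omega_exp_ppow a M : w ^+ (a * p ^ M) = w ^+ a.
Proof.
elim: M => [|M IHM]; first by rewrite expn0 muln1.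
rewrite expnSr mulnA exprM IHM -[p in _ ^+ p](prednK (prime_gt0 p_pr)) exprSr.
by rewrite exprAC (prim_expr_order (prim_padic_in prim_omega)) expr1n mul1r.
Qed.

Variables (sigma : gal_of {:K}) (h k n N : nat) (i j : nat) (x y : 'rV[K]_(ell p)).
Hypotheses (sigma_gen : generator ('Gal({:K} / 1%AS)%g) sigma).
Hypotheses (hk : p.-1 = (h * k)%N) (k_gt0 : (0 < k)%N).
Local Notation tau := (sigma ^+ k)%g.
Hypotheses (xE : A 1 tau x = w ^+ i *: x) (yE : A 1 tau y = w ^+ j *: y).
Hypotheses (yn : skel_into n y) (i_lt : (i < p.-1)%N) (j_lt : (j < p.-1)%N).
(** For e > 0 it holds vacuously, because y lies outside Gamma_(n+1), with n as in the theorem. *)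
Hypothesis y_ij : skel_into N y -> i = j.

Local Notation "a ~ b" := (skel_into N (a - b)) (at level 70).

Lemma skel_eq_trans a b c : a ~ b -> b ~ c -> a ~ c.
Proof.
move=> ab bc; have -> : a - c = (a - b) - (c - b) by rewrite opprB addrA subrK.
apply: skel_intoB => //; have -> : c - b = 0 - (b - c) by rewrite sub0r opprB.
apply: skel_intoB => // z z' _ _.
by rewrite -(subrr b) skel_formBx subrr rpred0.
Qed.

Lemma skel_eq_refl a : a ~ a.
Proof. by move=> z z' _ _; rewrite skel_formBx subrr rpred0. Qed.

Lemma skel_eq_sym a b : a ~ b -> b ~ a.
Proof.
move=> ab; have -> : b - a = (a - a) - (a - b) by rewrite subrr sub0r opprB.
exact: skel_intoB (skel_eq_refl a) ab.
Qed.

Lemma skel_eq_act u phi a b : cyc_units theta u -> a ~ b -> A u phi a ~ A u phi b.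
Proof. by move=> uU ab; rewrite -skel_actB; apply: skel_into_act. Qed.

Lemma skel_eq_scale c a b : c \in O -> a ~ b -> c *: a ~ c *: b.
Proof. by move=> cO ab; rewrite -scalerBr; apply: skel_intoZ. Qed.

Lemma skel_eq_unscale c a b : cyc_units theta c -> c *: a ~ c *: b -> a ~ b.
Proof.
move=> [c0 cO cVO] /(skel_eq_scale cVO).
by rewrite !scalerA mulVf // !scale1r.
Qed.

Definition skel_stab c := cyc_units theta c /\ A c 1%g y ~ y.

Lemma skel_stab1 : skel_stab 1.
Proof. by split; [apply: cyc_units1 | rewrite skel_act_1; apply: skel_eq_refl]. Qed.

Lemma skel_stabM c d : skel_stab c -> skel_stab d -> skel_stab (c * d).
Proof.
move=> [cU cy] [dU dy]; split; first exact: cyc_unitsM.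
have -> : A (c * d) 1%g y = A c 1%g (A d 1%g y) by rewrite skel_act_comp gal_id mulg1.
exact: skel_eq_trans (skel_eq_act 1%g cU dy) cy.
Qed.

Lemma skel_stabV c : skel_stab c -> skel_stab c^-1.
Proof.
move=> [cU cy]; have cVU := cyc_unitsV cU; split=> //.
have := skel_eq_act 1%g cVU (skel_eq_sym cy).
by rewrite skel_act_comp gal_id mulg1 mulVf ?cyc_units_neq0 // skel_act_1.
Qed.

Lemma skel_stabX c l : skel_stab c -> skel_stab (c ^+ l).
Proof.
move=> cS; elim: l => [|l IHl]; first exact: skel_stab1.
by rewrite exprS; apply: skel_stabM.
Qed.

(** Conjugation by (1, tau) preserves the stabiliser of its eigenvector y, and it acts on units as
    tau. *)
Lemma skel_stab_gal c : skel_stab c -> skel_stab (tau c).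
Proof.
move=> [cU cy]; split; first exact: gal_units.
have := skel_eq_act tau cyc_units1 cy; rewrite skel_act_comp mul1r mul1g.
have -> : A (tau c) tau y = A (tau c) 1%g (A 1 tau y).
  by rewrite skel_act_comp rmorph1 mulr1 mulg1.
rewrite yE skel_actZ gal_omega; apply: skel_eq_unscale; exact: omega_units.
Qed.

(** The exponent brings a 1-unit within kap^(N+p) of 1, the precision required by
    [skel_act_one_unit]. *)
Lemma skel_stab_ppow c : c - 1 \in I 1 -> cyc_units theta c -> skel_stab (c ^+ (p ^ (N + p))).
Proof.
move=> cI cU; have PU := cyc_unitsX (p ^ (N + p)) cU; split=> //.
apply: skel_act_one_unit yn PU _; apply: kap_powW (leqnSn _) _.
by apply: one_unit_exp_ppow => //; apply: cyc_units_int.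
Qed.

Lemma gal_ratio_residue (s : gal_of {:K}) u : cyc_units theta u -> s u / u - 1 \in I 1.
Proof.
move=> uU; have u0 := cyc_units_neq0 uU.
have -> : s u / u - 1 = u^-1 * (s u - u) by field.
by rewrite kap_pow_unit ?gal_residue ?cyc_units_int //; apply: cyc_unitsV.
Qed.

Lemma gal_exp_order : (sigma ^+ p.-1)%g = 1%g.
Proof.
apply: gal_eq_theta; have [r rp rE] := gal_theta sigma.
have expE l : (sigma ^+ l)%g theta = theta ^+ (r ^ l).
  elim: l => [|l IHl]; first by rewrite expg0 gal_id expr1.
  by rewrite expgSr galM ?memvf // IHl rmorphXn /= rE -exprM expnS.
rewrite expE gal_id -[RHS]expr1; apply/eqP.
by rewrite (eq_prim_root_expr prim_theta) -(totient_prime p_pr); apply/eqP/Euler_exp_totient.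
Qed.

Lemma skel_act_eigen s : A 1 (tau ^+ s)%g x = w ^+ (i * s) *: x.
Proof.
elim: s => [|s IHs]; first by rewrite muln0 expg0 skel_act_1 scale1r.
have -> : A 1 (tau ^+ s.+1)%g x = A 1 tau (A 1 (tau ^+ s)%g x).
  by rewrite skel_act_comp rmorph1 mulr1 expgSr.
by rewrite IHs skel_actZ xE gal_omega scalerA -exprD mulnS addnC.
Qed.

(* u is moved into ker chi by replacing its 1-unit part u2 with a power of the norm
   of u2 from K to the fixed field of tau. The exponent inverts h modulo a power of
   p, hence the change lies in the stabiliser of y. *)
Lemma skel_orbit_normal u phi : cyc_units theta u -> A u phi x ~ y ->
  i = j /\ exists v m, [/\ (m < k)%N, ker_chi theta tau v & A v (sigma ^+ m)%g x ~ y].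
Proof.
move=> uU; have /cycleP[t ->] : phi \in <[sigma]>%g.
  by rewrite -(eqP sigma_gen) mem_gal1.
set m := (t %% k)%N; set s := (t %/ k)%N.
have -> : (sigma ^+ t = tau ^+ s * sigma ^+ m)%g.
  by rewrite -expgM -expgD mulnC -divn_eq.
have -> : A u (tau ^+ s * sigma ^+ m)%g x = A u (sigma ^+ m)%g (A 1 (tau ^+ s)%g x).
  by rewrite skel_act_comp rmorph1 mulr1.
have wU a := omega_units prim_omega a; have w0 a := cyc_units_neq0 (wU a).
rewrite skel_act_eigen skel_actZ gal_omega scale_skel_act //; last by move=> *; apply: gal_omega.
set psi := (sigma ^+ m)%g; set u1 := _^-1 * u => H1.
have u1U : cyc_units theta u1 by apply: cyc_unitsM uU; apply: cyc_unitsV.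
clearbody u1; have u10 := cyc_units_neq0 u1U.
pose q := tau u1 / u1.
have qU : cyc_units theta q by apply: cyc_unitsM (gal_units _ u1U) (cyc_unitsV u1U).
have qy : w ^+ i *: A q 1%g y ~ w ^+ j *: y.
  have H2 := skel_eq_act tau cyc_units1 H1.
  have tE : A 1 tau (A u1 psi x) = w ^+ i *: A q 1%g (A u1 psi x).
    rewrite !skel_act_comp gal_id mul1r mulg1 divfK //.
    have -> : (psi * tau = tau * psi)%g by rewrite /psi -!expgD addnC.
    have -> : A (tau u1) (tau * psi)%g x = A (tau u1) psi (A 1 tau x).
      by rewrite skel_act_comp rmorph1 mulr1.
    by rewrite xE skel_actZ gal_omega.
  rewrite tE yE in H2; apply: skel_eq_trans H2.
  apply: skel_eq_scale; first exact: cyc_units_int.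
  exact: skel_eq_act qU (skel_eq_sym H1).
have qyl l : w ^+ (i * l) *: A (q ^+ l) 1%g y ~ w ^+ (j * l) *: y.
  elim: l => [|l IHl]; first by rewrite !muln0 skel_act_1; apply: skel_eq_refl.
  have := skel_eq_scale (cyc_units_int (wU i)) (skel_eq_act 1%g qU IHl).
  rewrite !skel_actZ !gal_omega skel_act_comp gal_id mulg1 -exprS scalerA -exprD -mulnS.
  move=> h1; apply: skel_eq_trans h1 _; rewrite scalerA mulrC -scalerA mulnS addnC exprD -scalerA.
  by apply: skel_eq_scale qy; apply: cyc_units_int.
have q1 : q - 1 \in I 1 by apply: gal_ratio_residue.
(* Raising to the power p^(N+p) makes q act trivially but keeps omega, since omega^p = omega. So
   (omega^i - omega^j) y vanishes, with a unit factor if i and j differ. *)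
have ij : i = j.
  apply/eqP; apply: contraT => ij; have := qyl (p ^ (N + p))%N.
  rewrite !omega_exp_ppow => h1.
  have /(skel_eq_scale (cyc_units_int (wU i))) h2 := (skel_stab_ppow q1 qU).2.
  have := skel_eq_trans (skel_eq_sym h2) h1; rewrite -scalerBl => h3.
  have [d0 dO dVO] := omega_diff_units prim_omega i_lt j_lt ij.
  have := skel_intoZ dVO h3; rewrite scalerA mulVf // scale1r => /y_ij.
  by move/eqP; rewrite (negPf ij).
split=> //.
have qS : skel_stab q.
  by split=> //; apply: (skel_eq_unscale (wU i)); rewrite {2}ij.
(* A cocycle: its values are products of tau-translates of q. *)
have qsS l : skel_stab ((tau ^+ l)%g u1 / u1).
  elim: l => [|l IHl]; first by rewrite expg0 gal_id divff //; apply: skel_stab1.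
  have -> : (tau ^+ l.+1)%g u1 / u1 = tau ((tau ^+ l)%g u1 / u1) * q.
    by rewrite expgSr galM ?memvf // rmorphM fmorphV /= /q mulrA divfK ?fmorph_eq0.
  by apply: skel_stabM qS; apply: skel_stab_gal.
(* The Teichmüller factor is fixed by tau, so only the 1-unit u2 has to be averaged. *)
have [a aI] := teichmuller_exists prim_omega u1U.
pose u2 := u1 / w ^+ a; have u2U : cyc_units theta u2 by apply: cyc_unitsM u1U (cyc_unitsV (wU a)).
have u20 := cyc_units_neq0 u2U.
have u2I : u2 - 1 \in I 1.
  have -> : u2 - 1 = (w ^+ a)^-1 * (u1 - w ^+ a) by rewrite /u2; field.
  by rewrite kap_pow_unit //; apply: cyc_unitsV.
pose P := (p ^ (N + p))%N.
(* h divides p - 1, which divides P - 1; thus -E inverts h modulo P. *)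
have [E hE] : exists E, P = (h * E).+1.
  exists (k * \sum_(l < N + p) p ^ l)%N; rewrite mulnA -hk -predn_exp prednK //.
  by rewrite expn_gt0 prime_gt0.
pose V := \prod_(l < h) (tau ^+ l)%g u2.
have VU : cyc_units theta V by apply: cyc_units_prod => l _; apply: gal_units.
have tauh : (tau ^+ h = 1)%g by rewrite -expgM mulnC -hk gal_exp_order.
have tauV : tau V = V.
  rewrite rmorph_prod; have h0 : (0 < h)%N.
    by rewrite lt0n; apply: contraTneq i_lt => h0; rewrite hk h0 mul0n ltn0.
  rewrite /V; case: h h0 tauh => // h' _ tauh.
  rewrite big_ord_recr [RHS]big_ord_recl /= -galM ?memvf // -expgSr tauh expg0 mulrC.
  congr (_ * _); apply: eq_bigr => l _.
  by rewrite -galM ?memvf // -expgSr.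
(* Modulo the stabiliser of y, V is u2^h, so V^E is u2^(P-1), that is, the inverse of u2; hence the
   quotient represents u1. *)
have vU : cyc_units theta (w ^+ a / V ^+ E).
  by apply: cyc_unitsM (wU a) (cyc_unitsV (cyc_unitsX E VU)).
exists (w ^+ a / V ^+ E), m; split; first by rewrite ltn_mod.
  split=> //; rewrite /chi rmorphM fmorphV /= gal_omega rmorphXn /= tauV.
  by rewrite divff // cyc_units_neq0.
set v := _ / _.
have vS : skel_stab (v / u1).
  have -> : v / u1 = ((\prod_(l < h) ((tau ^+ l)%g u1 / u1)) ^+ E * u2 ^+ P)^-1.
    have -> : \prod_(l < h) ((tau ^+ l)%g u1 / u1) = V / u2 ^+ h.
      rewrite -[X in _ / _ ^+ X](card_ord h) -prodr_const -prodf_div; apply: eq_bigr => l _.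
      by rewrite /u2 rmorphM fmorphV /= gal_omega; field; rewrite u10 w0.
    rewrite expr_div_n -exprM hE exprSr mulrA divfK ?expf_neq0 // /v /u2.
    by field; rewrite u10 w0 expf_neq0 ?cyc_units_neq0.
  apply: skel_stabV; apply: skel_stabM (skel_stab_ppow u2I u2U); apply: skel_stabX.
  by elim/big_rec: _ => [|l z _ zS]; [apply: skel_stab1 | apply: skel_stabM].
have -> : A v psi x = A (v / u1) 1%g (A u1 psi x).
  by rewrite skel_act_comp gal_id mulg1 divfK.
exact: skel_eq_trans (skel_eq_act 1%g vS.1 H1) vS.2.
Qed.

End NormalForm.

End CyclotomicIntegers.

(** For e = 0 the two groups coincide whatever i and j are, so an isomorphism carries no information
    on them; this is the reason for [e = 0 -> i = j]. *)
Theorem proposition5p2 (p : nat) (p_pr : prime p)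
  (K : splittingFieldType (padic_rat p_pr)) (theta : K)
  (omega : padic_int p_pr) (sigma : gal_of {:K})
  (h k n e : nat) (i j : 'I_p.-1) (x y : 'rV[K]_(ell p)) :
  (7 <= p)%N ->
  p.-primitive_root theta ->
  <<1%AS; theta>>%VS = {:K}%VS ->
  (p.-1).-primitive_root omega ->
  generator ('Gal({:K} / 1%AS)%g) sigma ->
  (0 < h)%N -> (0 < k)%N -> p.-1 = (h * k)%N ->
  let c := (2 * p - 8)%N in
  let tau : gal_of {:K} := (sigma ^+ k)%g in
  (maxn c 8 <= n)%N -> (e <= n - c)%N ->
  (e = 0%N -> i = j) ->
  Omega theta omega tau n i x ->
  Omega theta omega tau n j y ->
  mul_isomorphic (@sdskel_mul p p_pr K theta n e x)
                 (@sdskel_mul p p_pr K theta n e y)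
  <-> i = j /\
      exists (v : K) (m : 'I_k),
        ker_chi theta tau v /\
        Gamma theta (n + e)%N%:Z (skel_act theta v (sigma ^+ m)%g x - y).
Proof.
move=> p7 prim_theta gen_theta prim_omega sigma_gen h_gt0 k_gt0 hk c tau.
case: n => [|n']; first by rewrite geq_max andbF.
move=> cn en e0 [[xG _] xE] [[yG yG'] yE].
have xn := (GammaP theta n' x).1 xG; have yn := (GammaP theta n' y).1 yG.
have p_ge3 : (2 < p)%N by lia.
(* For p = 7 the bound n >= 8 gives p <= n - 1, and for p >= 9 the bound n >= c does; p = 8 would
   escape both. *)
have p8 : p <> 8%N by move=> p8; move: (p_pr); rewrite {1}p8.
have p_le_n : (p <= n')%N by rewrite /c in cn en; lia.
(* With c = 2p - 8 this amounts to p >= 7 in the extreme case e = n - c. *)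
have ep : (e + p <= n' + 2)%N by rewrite /c in cn en; lia.
have NE : (n'.+1 + e)%N = (n' + e).+1 by rewrite addSn.
rewrite NE; split=> [[F [F_bij F_morph]]|[_ [v [m [[vU _] /GammaP xy]]]]]; last first.
  exact: (skel_act_iso prim_theta gen_theta p_ge3 p_le_n xn yn vU xy).
(* For e = 0 the congruence modulo Gamma_n is free, as x and y both lie in Gamma_n. *)
case: (posnP e) => [e_0|e_gt0].
  split; first exact: e0.
  exists 1, (Ordinal k_gt0); split.
    split; first exact: cyc_units1.
    by rewrite /chi rmorph1 invr1 mulr1.
  by apply/GammaP; rewrite e_0 addn0 expg0 skel_act_1; apply: skel_intoB.
have [u [phi [uU xy]]] :=
  skel_iso_act prim_theta gen_theta p_ge3 p_le_n xn yn e_gt0 ep F_bij F_morph.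
have xE' : skel_act theta 1 tau x = padic_in K omega ^+ i *: x by rewrite -rmorphXn.
have yE' : skel_act theta 1 tau y = padic_in K omega ^+ j *: y by rewrite -rmorphXn.
have y_ij : skel_into theta (n' + e) y -> i = j :> nat.
  move=> yN; case: yG'; have -> : n'.+1%:Z + 1 = n'.+2%:Z by rewrite -PoszD addn1.
  by apply/GammaP; apply: skel_intoW yN; lia.
have [ij [v [m [m_lt v_ker vm]]]] := skel_orbit_normal prim_theta gen_theta prim_omega
  sigma_gen hk k_gt0 xE' yE' yn (ltn_ord i) (ltn_ord j) y_ij uU xy.
split; first exact: val_inj.
by exists v, (Ordinal m_lt); split=> //; apply/GammaP.
Qed.
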